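(* Let $\mathbb{K}$ be a field, $S=\mathbb{K}[x_1,\dots,x_n]$, and let $I\subseteq S$ be a quadratic (not necessarily squarefree) monomial ideal, i.e. a monomial ideal generated by monomials of degree $2$, with linear resolution. Then $S/I$ satisfies Stanley's conjecture, that is, ${\rm depth}(S/I)\leq {\rm sdepth}(S/I)$.
   Context: A monomial ideal $I$ has linear resolution if for some integer $t$ the graded Betti numbers $\beta_{i,i+j}(I)$ vanish for all $i$ and every $j\neq t$. Stanley depth: let $M$ be a nonzero finitely generated $\mathbb{Z}^n$-graded $S$-module. For a homogeneous $u\in M$ and $Z\subseteq\{x_1,\dots,x_n\}$, the $\mathbb{K}$-subspace $u\mathbb{K}[Z]$ generated by all $uv$ with $v\in\mathbb{K}[Z]$ is called a Stanley space of dimension $|Z|$ if it is a free $\mathbb{K}[Z]$-module. A Stanley decomposition $\mathcal{D}$ of $M$ is a decomposition of $M$ as a finite direct sum of Stanley spaces; ${\rm sdepth}(\mathcal{D})$ is the minimum dimension of a Stanley space in $\mathcal{D}$, and ${\rm sdepth}(M)$ is the maximum of ${\rm sdepth}(\mathcal{D})$ over all Stanley decompositions $\mathcal{D}$ of $M$. *)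

(* Defs.v *)
From HB Require Import structures.
From mathcomp Require Import all_boot all_order all_algebra.
From mathcomp Require Import mpoly.
From Stdlib Require Import ClassicalEpsilon.

Set Implicit Arguments.
Unset Strict Implicit.
Unset Printing Implicit Defensive.
Import GRing.Theory.
Local Open Scope ring_scope.

(* Subsets of S = K[x_1,...,x_n] (ideals in particular) are predicates
   S -> Prop. A quotient module S/I is handled through representatives in S,
   with equality of classes meaning that the difference lies in I. *)

(* The greatest element of P; unspecified when P has no greatest element. *)
Definition greatest (P : nat -> Prop) : nat :=
  epsilon (inhabits 0%N) (fun d => P d /\ forall e, P e -> (e <= d)%N).

Section Ideals.
Variables (K : fieldType) (n : nat).
Local Notation S := {mpoly K[n]}.

Definition ideal_gen (A : S -> Prop) (f : S) : Prop :=
  exists2 s : seq (S * S),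
    forall c, c \in s -> A c.2 & f = \sum_(c <- s) c.1 * c.2.

Definition quadratic_monomial_ideal (I : S -> Prop) : Prop :=
  exists2 G : 'X_{1..n} -> Prop,
    forall m, G m -> mdeg m = 2%N &
    forall f, I f <-> ideal_gen (fun g => exists2 m, G m & g = 'X_[m]) f.

Definition graded_maximal_ideal : S -> Prop :=
  ideal_gen (fun g => exists i : 'I_n, g = 'X_i).

End Ideals.

Section Resolutions.
Variables (K : fieldType) (n : nat).
Local Notation S := {mpoly K[n]}.

(* The degree is an integer since differences of shifts may be negative;
   0 is homogeneous of every degree. *)
Definition homogeneous (d : int) (f : S) : Prop :=
  forall m, m \in msupp f -> (mdeg m)%:Z = d.

(* A sequence ... -> F_1 -> F_0 -> S of maps of free modules, where F_i is the
   direct sum of the S(- shift i p), p < rank i. Elements of F_i are row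
   vectors, and the maps act by right multiplication by matrices. *)
Record free_sequence := FreeSequence {
  rank : nat -> nat;
  shift : forall i, 'I_(rank i) -> int;
  augmentation : 'cV[S]_(rank 0);
  differential : forall i, 'M[S]_(rank i.+1, rank i)
}.

(* Exactness of ... -> F_1 -> F_0 -> I -> 0, with maps of degree 0. *)
Definition graded_free_resolution (I : S -> Prop) (F : free_sequence) : Prop :=
  [/\ forall p, homogeneous (shift p) (augmentation F p 0),
      forall i p q,
        homogeneous (shift p - shift q) (differential F i p q) &
      [/\ forall f, I f <-> exists v : 'rV_(rank F 0), v *m augmentation F = f%:M,
      forall v : 'rV_(rank F 0), v *m augmentation F = 0 <->
        exists w : 'rV_(rank F 1), v = w *m differential F 0 &
      forall i (v : 'rV_(rank F i.+1)), v *m differential F i = 0 <->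
        exists w : 'rV_(rank F i.+2), v = w *m differential F i.+1]].

Definition minimal (F : free_sequence) : Prop :=
  forall i p q, graded_maximal_ideal (differential F i p q).

(* If F is a minimal graded free resolution of I, this is beta_{i,j}(I). *)
Definition graded_betti (F : free_sequence) (i : nat) (j : int) : nat :=
  #|[pred p : 'I_(rank F i) | shift p == j]|.

(* A minimal graded free resolution exists and is unique up to isomorphism,
   so the choice of F is immaterial. *)
Definition linear_resolution (I : S -> Prop) : Prop :=
  exists F : free_sequence,
    [/\ graded_free_resolution I F, minimal F &
        exists t : int, forall (i : nat) (j : int),
          j != t -> graded_betti F i (i%:Z + j) = 0%N].

End Resolutions.

Section Depth.
Variables (K : fieldType) (n : nat).
Local Notation S := {mpoly K[n]}.

Definition add_ideal (I : S -> Prop) (s : seq S) : S -> Prop :=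
  ideal_gen (fun g => I g \/ g \in s).

Definition regular_sequence (I : S -> Prop) (s : seq S) : Prop :=
  (forall i g, (i < size s)%N ->
     add_ideal I (take i s) (s`_i * g) -> add_ideal I (take i s) g) /\
  ~ add_ideal I s 1.

(* depth(S/I), as the maximal length of an (S/I)-regular sequence in the
   graded maximal ideal. *)
Definition depth (I : S -> Prop) : nat :=
  greatest (fun d => exists s : seq S,
    [/\ size s = d, forall f, f \in s -> graded_maximal_ideal f &
        regular_sequence I s]).

End Depth.

Section StanleyDepth.
Variables (K : fieldType) (n : nat).
Local Notation S := {mpoly K[n]}.

Definition in_subring (Z : {set 'I_n}) (v : S) : Prop :=
  forall m, m \in msupp v -> forall i, m i != 0%N -> i \in Z.

(* Homogeneity for the Z^n-grading: the component of degree a is spanned by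
   the monomial x^a. *)
Definition multihomogeneous (u : S) : Prop :=
  exists (c : K) (a : 'X_{1..n}), u = c *: 'X_[a].

(* u K[Z], inside S/I, is a free K[Z]-module with basis the class of u. *)
Definition stanley_space (I : S -> Prop) (u : S) (Z : {set 'I_n}) : Prop :=
  multihomogeneous u /\
  forall v, in_subring Z v -> I (u * v) -> v = 0.

Record stanley_family := StanleyFamily {
  len : nat;
  gen : 'I_len -> S;
  vars : 'I_len -> {set 'I_n}
}.

(* S/I is the direct sum of the subspaces (gen k) K[vars k], k < len D. *)
Definition stanley_decomposition (I : S -> Prop) (D : stanley_family) : Prop :=
  [/\ forall k : 'I_(len D), stanley_space I (gen k) (vars k),
      forall f, exists2 v : 'I_(len D) -> S,
        forall k, in_subring (vars k) (v k) &
        I (f - \sum_k gen k * v k) &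
      forall v : 'I_(len D) -> S,
        (forall k, in_subring (vars k) (v k)) ->
        I (\sum_k gen k * v k) -> forall k, I (gen k * v k)].

(* The default value n is never used when S/I is nonzero: D is then nonempty,
   and every dimension is at most n. *)
Definition sdepth_decomposition (D : stanley_family) : nat :=
  \big[minn/n]_(k < len D) #|vars k|.

(* The Stanley depth of S/I, not of I. *)
Definition sdepth (I : S -> Prop) : nat :=
  greatest (fun d => exists2 D : stanley_family,
    stanley_decomposition I D & sdepth_decomposition D = d).

End StanleyDepth.

(* Main.v *)
(* Let [adj i j] mean that x_i x_j is not in I (i = j allowed), and view it as a graph with
   loops. Everything is read off the Koszul complex of the variables. Comparing it with the
   linear resolution shows that a Koszul cycle of S/I with coefficients of degree at least 2 is a
   boundary; explicit cycles then force the minimal vertex cuts of every induced subgraph to be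
   cliques, so that the graph is chordal, and force the vertices without loop to be independent
   and simplicial. Conversely, a regular sequence of length d makes every Koszul cycle of S/I of
   homological degree larger than n - d a boundary, so that d is at most 1 + |T| for every
   vertex cut T and at most the degree of every vertex without loop. Removing simplicial vertices
   v one at a time, those without loop first, splits the standard monomials into the boxes
   x_v K[neighbours of v in the remaining graph] (v included when it carries a loop) and a last
   box K[clique]; the two bounds say that all of them have dimension at least d. *)

Require Import Defs.
From mathcomp Require Import all_boot all_order all_algebra.
From mathcomp Require Import mpoly ring.
From Stdlib Require Import ClassicalEpsilon.

Set Implicit Arguments.
Unset Strict Implicit.
Unset Printing Implicit Defensive.
Import GRing.Theory.
Local Open Scope ring_scope.

(** * The Koszul complex *)

Section Koszul.
Variables (K : fieldType) (n : nat).
Local Notation S := {mpoly K[n]}.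
Implicit Types (i j k : 'I_n) (A B D : {set 'I_n}) (m : 'X_{1..n}).

(** The sign of moving e_j into its place in e_j wedge e_A. It is taken in any ring because it
    multiplies both polynomials and their coefficients. *)
Definition ksgn (R : pzRingType) j A : R := (-1) ^+ #|[set k in A | (k < j)%N]|.

Lemma ksgn_sqr (R : pzRingType) j A : ksgn R j A * ksgn R j A = 1.
Proof. by rewrite /ksgn -expr2 sqrr_sign. Qed.

Lemma ksgnU1 (R : pzRingType) j k A : j \notin A ->
  ksgn R k (j |: A) = (-1) ^+ (j < k)%N * ksgn R k A.
Proof.
move=> jA; rewrite /ksgn -exprD; congr (_ ^+ _).
case: (ltnP j k) => jk.
  have -> : [set l in j |: A | (l < k)%N] = j |: [set l in A | (l < k)%N].
    by apply/setP=> l; rewrite !inE; case: eqP => [->|//]; rewrite jk.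
  by rewrite cardsU1 !inE (negPf jA).
rewrite add0n; apply/eq_card => l; rewrite !inE.
by case: eqP => [->|//]; rewrite ltnNge jk !andbF.
Qed.

(** Anticommutation of e_j and e_k: exactly one of the two indices precedes the other, so exactly
    one sign changes. *)
Lemma ksgnU1_mul (R : comNzRingType) j k A : j != k -> j \notin A -> k \notin A ->
  ksgn R j (k |: A) * ksgn R k (j |: A) = - (ksgn R j A * ksgn R k A).
Proof.
move=> jk jA kA; rewrite !ksgnU1 //.
have : (k < j)%N = ~~ (j < k)%N.
  by rewrite -leqNgt [in RHS]leq_eqVlt eq_sym (inj_eq val_inj) (negPf jk).
by case: (j < k)%N => -> /=; rewrite ?expr0 ?expr1 ?mul1r ?mulN1r ?mulrN ?mulNr.
Qed.

Lemma ksgn_swap (R : comNzRingType) j k A : j != k -> j \notin A -> k \notin A ->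
  ksgn R j A * ksgn R k (j |: A) = - (ksgn R k A * ksgn R j (k |: A)).
Proof.
move=> jk jA kA; have := ksgnU1_mul R jk jA kA.
move/(congr1 (fun x => ksgn R j A * ksgn R j (k |: A) * x)).
rewrite -mulrA [ksgn R j (k |: A) * _]mulrA ksgn_sqr mul1r => ->.
by rewrite mulrN mulrACA ksgn_sqr mul1r mulrC.
Qed.

(* An element of the Koszul complex with values in V is encoded, in all homological degrees at
   once, by the function giving its coefficient of e_A, the wedge of the e_j for j in A. *)
Definition kd (V : lmodType S) (f : {set 'I_n} -> V) A : V :=
  \sum_(j | j \notin A) (ksgn S j A * 'X_j) *: f (j |: A).

(* Left multiplication by e_j. *)
Definition kh j (f : {set 'I_n} -> S^o) A : S^o :=
  if j \in A then ksgn S j (A :\ j) * f (A :\ j) else 0.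

Lemma eq_kd (V : lmodType S) (f g : {set 'I_n} -> V) : f =1 g -> kd f =1 kd g.
Proof. by move=> fg A; apply: eq_bigr => j _; rewrite fg. Qed.

Lemma kdD (V : lmodType S) (f g : {set 'I_n} -> V) A :
  kd (fun D => f D + g D) A = kd f A + kd g A.
Proof. by rewrite -big_split; apply: eq_bigr => j _; rewrite scalerDr. Qed.

Lemma kdN (V : lmodType S) (f : {set 'I_n} -> V) A : kd (fun D => - f D) A = - kd f A.
Proof. by rewrite /kd -sumrN; apply: eq_bigr => j _; rewrite scalerN. Qed.

Lemma kdB (V : lmodType S) (f g : {set 'I_n} -> V) A :
  kd (fun D => f D - g D) A = kd f A - kd g A.
Proof. by rewrite kdD kdN. Qed.

Lemma kd0 (V : lmodType S) (f : {set 'I_n} -> V) A : (forall D, f D = 0) -> kd f A = 0.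
Proof. by move=> f0; apply: big1 => j _; rewrite f0 scaler0. Qed.

Lemma kd_kd (V : lmodType S) (f : {set 'I_n} -> V) A : kd (kd f) A = 0.
Proof.
pose F j k := (ksgn S j A * 'X_j) *: ((ksgn S k (j |: A) * 'X_k) *: f (k |: (j |: A))).
have FN j k : j != k -> j \notin A -> k \notin A -> F j k = - F k j.
  move=> jk jA kA; rewrite /F !scalerA -scaleNr; congr (_ *: f _); last by rewrite setUCA.
  by rewrite mulrACA ksgn_swap // [in RHS]mulrACA mulNr ['X_j * _]mulrC.
(* Split into j < k and k < j; exchanging the sums in one half matches every term with its negative
   by [FN]. *)
have -> : kd (kd f) A = \sum_(j | j \notin A) (\sum_(k | (k \notin A) && (j < k)%N) F j k
                                 + \sum_(k | (k \notin A) && (k < j)%N) F j k).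
  apply: eq_bigr => j jA; rewrite scaler_sumr (bigID (fun k => (j < k)%N)) /=.
  congr (_ + _); apply: eq_bigl => k; rewrite !inE negb_or.
    by case: (k \notin A); rewrite ?andbF // andbT; case: eqP => [->|//]; rewrite ltnn.
  rewrite -leqNgt leq_eqVlt (inj_eq val_inj) [k == j]eq_sym andbC.
  by case: eqP => [->|]; rewrite ?ltnn ?andbF //= andbC.
rewrite big_split /= [X in _ + X](exchange_big_dep (fun k => k \notin A)) /=; last first.
  by move=> j k _ /andP[].
rewrite -big_split big1 //= => j jA; apply/eqP; rewrite addr_eq0 -sumrN; apply/eqP.
by apply: eq_big => [k|k /andP[kA jk]]; rewrite ?jA //= FN ?neq_ltn ?jk.
Qed.

Lemma scale_regE (a b : S) : a *: (b : S^o) = a * b.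
Proof. by []. Qed.

(** Wedge with e_i is a homotopy from multiplication by x_i to 0: contracting i leaves x_i, and
    contractions of other indices cancel or vanish. *)
Lemma kd_kh i (f : {set 'I_n} -> S^o) A : kd (kh i f) A + kh i (kd f) A = 'X_i * f A.
Proof.
rewrite {2}/kh; case: ifPn => iA.
  have iAi : i \notin A :\ i by rewrite !inE eqxx.
  rewrite [kd f _]/kd (bigD1 i) //= setD1K // mulrDr addrCA -[RHS]addr0.
  congr (_ + _); first by rewrite scale_regE !mulrA ksgn_sqr mul1r.
  apply/eqP; rewrite addr_eq0 mulr_sumr -sumrN; apply/eqP.
  apply: eq_big => [j|j jA].
    rewrite !inE negb_and negbK; case: eqP => [->|_]; by rewrite ?iA ?andbT.
  have ji : j != i by apply: contraNneq jA => ->.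
  have E : (j |: A) :\ i = j |: A :\ i.
    by apply/setP=> l; rewrite !inE; case: (l =P j) => [->|]; rewrite ?ji.

  have jAi : j \notin A :\ i by rewrite !inE negb_and jA orbT.
  rewrite /kh !inE iA orbT E !scale_regE !mulrA -mulNr; congr (_ * _).
  have := ksgnU1_mul S ji jAi iAi; rewrite setD1K // => E2.
  by rewrite mulrAC E2 mulNr [X in X * _]mulrC.
rewrite addr0 /kd (bigD1 i) //= /kh setU11 setU1K // big1 ?addr0.
  by rewrite scale_regE mulrA [_ * 'X_i]mulrC -['X_i * _ * _]mulrA ksgn_sqr mulr1.
by move=> j /andP[_ ji]; rewrite !inE eq_sym (negPf ji) (negPf iA) scaler0.
Qed.

(** Division by x^u on the monomials in P. It serves for the contracting homotopy and later for
    coordinates in Stanley spaces. *)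
Definition mdivX (P : pred 'X_{1..n}) (u : 'X_{1..n}) (p : S) : S :=
  \sum_(m <- msupp p | P m && (u <= m)%MM) p@_m *: 'X_[m - u].

Lemma mcoeff_mdivX P u p m : (mdivX P u p)@_m = if P (m + u)%MM then p@_(m + u) else 0.
Proof.
have E m' : (u <= m')%MM -> ((m' - u)%MM == m) = (m' == (m + u)%MM).
  by move=> um'; rewrite -(eqm_add2r u) submK.
rewrite /mdivX raddf_sum /= big_mkcond /=.
case: (boolP ((m + u)%MM \in msupp p)) => mp; last first.
  rewrite (memN_msupp_eq0 mp) if_same big1_seq // => m' /andP[_ m'p].
  case: ifP => // /andP[_ um']; rewrite mcoeffZ mcoeffX E //.
  by case: eqP m'p => [->|_]; rewrite ?(negPf mp) // mulr0.
rewrite (bigD1_seq _ mp (msupp_uniq _)) /= lem_addl andbT big1 ?addr0.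
  by case: ifP => // _; rewrite mcoeffZ mcoeffX E ?lem_addl // eqxx mulr1.
move=> m' m'm; case: ifP => // /andP[_ um'].
by rewrite mcoeffZ mcoeffX E // (negPf m'm) mulr0.
Qed.

Lemma mcoeffXM j (p : S) m : ('X_j * p)@_m = if m j != 0%N then p@_(m - U_(j)) else 0.
Proof.
rewrite mulrC; case: ifPn => [mj|].
  have mE : (m - U_(j) + U_(j))%MM = m by rewrite submK ?lep1mP.
  by rewrite -[in LHS]mE addmC mcoeffMX.
move=> mj; apply: memN_msupp_eq0; apply: contra mj.
rewrite (perm_mem (msuppMX _ _)) => /mapP[m' _ ->].
by rewrite mnmDE mnm1E eqxx.
Qed.

Lemma mcoeff_ksgnM j A (p : S) m : (ksgn S j A * p)@_m = ksgn K j A * p@_m.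
Proof.
by rewrite /ksgn -signr_odd -[in RHS]signr_odd; case: odd; rewrite ?mul1r // !mulN1r mcoeffN.
Qed.

Lemma mcoeff_kd (f : {set 'I_n} -> S^o) A m : (kd f A : S)@_m =
  \sum_(j | (j \notin A) && (m j != 0%N)) ksgn K j A * (f (j |: A) : S)@_(m - U_(j)).
Proof.
rewrite /kd raddf_sum /= big_mkcondr; apply: eq_bigr => j jA.
rewrite scale_regE -mulrA mcoeff_ksgnM mcoeffXM.
by case: ifP => // _; rewrite mulr0.
Qed.

(* On the part of multidegree a <> 0 (the monomial m at e_A has multidegree m + 1_A), wedge with
   e_k and divide by x_k, where k is the least index in the support of a: there this is a
   contracting homotopy. The filter keeps those m for which k is this least index. *)
Definition kH (f : {set 'I_n} -> S^o) A : S^o :=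
  \sum_(k in A) ksgn S k (A :\ k) *
    mdivX (fun m => [forall l : 'I_n, (l < k)%N ==> (m l == 0%N) && (l \notin A)]) U_(k) (f (A :\ k)).

(** Here k is the least index in A or in the support of m, so the filter kills every summand other
    than that of k. *)
Lemma mcoeff_kH f A m k : (k \in A) || (m k != 0%N) ->
    (forall l : 'I_n, (l < k)%N -> (m l == 0%N) && (l \notin A)) ->
  (kH f A : S)@_m =
    if k \in A then ksgn K k (A :\ k) * (f (A :\ k) : S)@_(m + U_(k)) else 0.
Proof.
move=> kAm kmin; rewrite /kH raddf_sum /=.
have E k' : k' \in A -> k' != k -> (ksgn S k' (A :\ k') *
    mdivX (fun m => [forall l : 'I_n, (l < k')%N ==> (m l == 0%N) && (l \notin A)])
     U_(k') (f (A :\ k')))@_m = 0.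
  move=> k'A k'k; rewrite mcoeff_ksgnM mcoeff_mdivX ifN ?mulr0 //.
  apply/forallPn; exists k; rewrite negb_imply ltn_neqAle [k == k' :> nat]eq_sym (inj_eq val_inj) k'k.
  rewrite leqNgt; have [/kmin|_] := ltnP k' k; first by rewrite k'A andbF.
  rewrite /= negb_and negbK mnmDE addn_eq0 mnm1E (negPf k'k) andbT.
  by rewrite orbC.
case: ifPn => kA; last first.
  by apply: big1 => k' k'A; apply: E => //; apply: contraNneq kA => <-.
rewrite (bigD1 k) //= big1 ?addr0 => [|k' /andP[]]; last exact: E.
rewrite mcoeff_ksgnM mcoeff_mdivX ifT //; apply/forallP=> l; apply/implyP=> lk.
rewrite mnmDE mnm1E; case: (k =P l) lk => [->|_ lk]; first by rewrite ltnn.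
by rewrite addn0 kmin.
Qed.

(** Acyclicity of the Koszul complex of S: its only homology is the constant term at [set0]. The
    check is done one coefficient at a time. *)
Lemma kd_kH (f : {set 'I_n} -> S^o) A : (forall D, kd f D = 0) -> (f set0 : S)@_0 = 0 -> kd (kH f) A = f A.
Proof.
move=> df0 f00; apply/mpolyP => m.
have [/existsP[k0 k0P]|] := boolP [exists k, (k \in A) || (m k != 0%N)]; last first.
  rewrite negb_exists => /forallP noP.
  have -> : A = set0 by apply/setP=> k; rewrite inE; apply/negbTE; have := noP k; rewrite negb_or => /andP[].
  have -> : m = 0%MM.
    by apply/mnmP=> k; rewrite mnm0E; apply/eqP; have := noP k; rewrite negb_or negbK => /andP[].
  by rewrite f00 mcoeff_kd big1 // => j; rewrite mnm0E andbF.
pose k := [arg min_(k < k0 | (k \in A) || (m k != 0%N)) (k : nat)].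
have [kP kmin] : ((k \in A) || (m k != 0%N)) /\ (forall l : 'I_n, (l < k)%N -> (m l == 0%N) && (l \notin A)).
  rewrite /k; case: arg_minnP => // i iP imin; split=> // l; rewrite ltnNge; apply: contraR => H.
  by apply: imin; rewrite orbC -[l \in A]negbK -negb_and.
(* Moving x_j from m into the index set keeps the multidegree, hence also the least index k. *)
have minU j : j \notin A -> m j != 0%N ->
    (kH f (j |: A) : S)@_(m - U_(j)) = if k \in j |: A then
      ksgn K k ((j |: A) :\ k) * (f ((j |: A) :\ k) : S)@_(m - U_(j) + U_(k)) else 0.
  move=> jA mj; apply: mcoeff_kH.
    rewrite !inE mnmBE mnm1E [k == j]eq_sym; case: eqP => //= _.
    by rewrite subn0.
  move=> l lk; have /andP[ml lA] := kmin l lk.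
  rewrite !inE negb_or lA mnmBE (eqP ml) sub0n eqxx andbT.
  by apply: contraTneq ml => ->.
rewrite mcoeff_kd; have [kA|kA] := boolP (k \in A); last first.
  have mk : m k != 0%N by rewrite (negPf kA) in kP.
  rewrite (bigD1 k) /= ?kA ?mk // big1 ?addr0.
    by rewrite minU // setU11 setU1K // submK ?lep1mP // mulrA ksgn_sqr mul1r.
  move=> j /andP[/andP[jA mj] jk]; rewrite minU // !inE eq_sym (negPf jk) (negPf kA).
  by rewrite mulr0.
have kAk : k \notin A :\ k by rewrite !inE eqxx.
(* For k in A the value comes from the cycle condition at [A :\ k]: its term for k is the
   coefficient sought, and its other terms match those of [kd (kH f) A]. *)
have := congr1 (fun p : S => p@_(m + U_(k))) (df0 (A :\ k)).
rewrite mcoeff_kd (bigD1 k) /=; last by rewrite kAk mnmDE mnm1E eqxx addn1.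
rewrite setD1K // addmK mcoeff0 => /eqP; rewrite addr_eq0 => /eqP E.
rewrite -[RHS]mul1r -(ksgn_sqr _ k (A :\ k)) -mulrA E mulrN mulr_sumr -sumrN.
apply: eq_big => [j|j /andP[jA mj]].
  rewrite !inE negb_and negbK mnmDE mnm1E [k == j]eq_sym.
  by case: (j =P k) => [->|_]; rewrite ?kA ?andbF //= addn0 andbT.
have jk : j != k by apply: contraNneq jA => ->.
have jAk : j \notin A :\ k by rewrite !inE negb_and jA orbT.
have sE : (j |: A) :\ k = j |: A :\ k.
  by apply/setP=> l; rewrite !inE; case: (l =P j) => [->|]; rewrite ?jk.
have mE : (m - U_(j) + U_(k) = m + U_(k) - U_(j))%MM.
  by rewrite addmC addmBA ?lep1mP // [(U_(k) + m)%MM]addmC.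
rewrite minU // !inE kA orbT sE mE !mulrA -mulNr; congr (_ * _).
have := ksgnU1_mul K jk jAk kAk; rewrite setD1K // => ->.
by rewrite mulrC.
Qed.

End Koszul.

Lemma function_choice (T U : Type) (R : T -> U -> Prop) :
  (forall x, exists y, R x y) -> exists f, forall x, R x (f x).
Proof.
move=> H; exists (fun x => proj1_sig (constructive_indefinite_description _ (H x))) => x.
exact: proj2_sig (constructive_indefinite_description _ (H x)).
Qed.

(** * Ideals and regular sequences *)

Section IdealLemmas.
Variables (K : fieldType) (n : nat).
Local Notation S := {mpoly K[n]}.
Implicit Types (I J : S -> Prop) (f g : S) (A D : {set 'I_n}).

Definition is_ideal J :=
  [/\ J 0, forall f g, J f -> J g -> J (f + g) & forall a f, J f -> J (a * f)].

Lemma ideal_genP (A : S -> Prop) : is_ideal (ideal_gen A).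
Proof.
split; first by exists [::]; rewrite ?big_nil.
  move=> _ _ [s1 As1 ->] [s2 As2 ->]; exists (s1 ++ s2); last by rewrite big_cat.
  by move=> c; rewrite mem_cat => /orP[/As1|/As2].
move=> a _ [s As ->]; exists [seq (a * c.1, c.2) | c <- s].
  by move=> _ /mapP[c /As Ac ->].
by rewrite big_map mulr_sumr; apply: eq_bigr => c _; rewrite mulrA.
Qed.

Lemma mem_ideal_gen (A : S -> Prop) f : A f -> ideal_gen A f.
Proof.
move=> Af; exists [:: (1, f)]; last by rewrite big_seq1 mul1r.
by move=> c; rewrite mem_seq1 => /eqP ->.
Qed.

Section Closure.
Variable (J : S -> Prop).
Hypothesis idJ : is_ideal J.

Lemma ideal0 : J 0. Proof. by case: idJ. Qed.
Lemma idealD f g : J f -> J g -> J (f + g). Proof. by case: idJ => _ H _; exact: H. Qed.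
Lemma idealM a f : J f -> J (a * f). Proof. by case: idJ => _ _ H; exact: H. Qed.
Lemma idealN f : J f -> J (- f). Proof. by rewrite -mulN1r; exact: idealM. Qed.
Lemma idealB f g : J f -> J g -> J (f - g). Proof. by move=> Jf /idealN; exact: idealD. Qed.
Lemma ideal_sum (T : Type) (r : seq T) (P : pred T) (F : T -> S) :
  (forall i, P i -> J (F i)) -> J (\sum_(i <- r | P i) F i).
Proof. by move=> JF; elim/big_ind: _ => //; [exact: ideal0 | exact: idealD]. Qed.

Lemma ideal_gen_min (A : S -> Prop) f : (forall g, A g -> J g) -> ideal_gen A f -> J f.
Proof.
move=> AJ [s As ->]; rewrite big_seq; apply: ideal_sum => c /As /AJ; exact: idealM.
Qed.

Lemma ideal_kd (f : {set 'I_n} -> S^o) A : (forall D, J (f D)) -> J (kd f A).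
Proof. by move=> Jf; apply: ideal_sum => j _; apply: idealM. Qed.

Lemma ideal_kh j (f : {set 'I_n} -> S^o) A : (forall D, J (f D)) -> J (kh j f A).
Proof. by move=> Jf; rewrite /kh; case: ifP => _; [apply: idealM | exact: ideal0]. Qed.

End Closure.

Lemma add_ideal_rcons I s x f : add_ideal I (rcons s x) f ->
  exists a, add_ideal I s (f - x * a).
Proof.
pose J f := exists a, add_ideal I s (f - x * a).
have idA := ideal_genP (fun g => I g \/ g \in s).
apply: (@ideal_gen_min J); first split.
- by exists 0; rewrite mulr0 subr0; exact: ideal0.
- move=> f1 f2 [a1 J1] [a2 J2]; exists (a1 + a2).
  by rewrite mulrDr opprD addrACA; exact: idealD.
- by move=> a f1 [a1 J1]; exists (a * a1); rewrite mulrCA -mulrBr; exact: idealM.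
move=> g [Ig|]; first by exists 0; rewrite mulr0 subr0; apply: mem_ideal_gen; left.
rewrite mem_rcons inE => /orP[/eqP ->|gs].
  by exists 1; rewrite mulr1 subrr; exact: ideal0.
by exists 0; rewrite mulr0 subr0; apply: mem_ideal_gen; right.
Qed.

Lemma graded_maximal_idealE f : graded_maximal_ideal f ->
  exists g : 'I_n -> S, f = \sum_j g j * 'X_j.
Proof.
apply: (@ideal_gen_min (fun f => exists g : 'I_n -> S, f = \sum_j g j * 'X_j)).
  split.
  - by exists (fun _ => 0); rewrite big1 // => j _; rewrite mul0r.
  - move=> _ _ [g1 ->] [g2 ->]; exists (fun j => g1 j + g2 j).
    by rewrite -big_split; apply: eq_bigr => j _; rewrite mulrDl.
  - move=> a _ [g ->]; exists (fun j => a * g j).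
    by rewrite mulr_sumr; apply: eq_bigr => j _; rewrite mulrA.
move=> _ [i ->]; exists (fun j => (j == i)%:R); rewrite (bigD1 i) //= eqxx mul1r.
by rewrite big1 ?addr0 // => j /negPf ->; rewrite mul0r.
Qed.

Lemma kd_lincomb (g : 'I_n -> S) (F : 'I_n -> {set 'I_n} -> S^o) A :
  kd (fun D => \sum_j g j * F j D : S^o) A = \sum_j g j * kd (F j) A.
Proof.
rewrite /kd; under eq_bigr do rewrite scale_regE mulr_sumr.
rewrite exchange_big; apply: eq_bigr => j _; rewrite mulr_sumr; apply: eq_bigr => k _.
by rewrite scale_regE mulrCA.
Qed.

(* Multiplication by [s`_k] is null-homotopic: [s`_k * z] is the boundary of some w modulo the
   first k elements, and w is a cycle one degree higher modulo one more element of the sequence,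
   hence a boundary there by induction. *)
Lemma regular_sequence_koszul I (s : seq S) : (forall f, f \in s -> graded_maximal_ideal f) ->
  regular_sequence I s -> forall e k (z : {set 'I_n} -> S^o), (k + e = size s)%N ->
  (forall A, (#|A| + e <= n)%N -> z A = 0) ->
  (forall A, add_ideal I (take k s) (kd z A)) ->
  exists g : {set 'I_n} -> S^o, forall A, add_ideal I (take k s) (z A - kd g A).
Proof.
move=> maxs [regs _]; elim=> [|e IH] k z.
  (* At e = 0 the support condition covers every A, so z = 0. *)
  move=> _ z0 _; exists (fun _ => 0) => A; rewrite kd0 // z0.
    by rewrite subr0; exact: ideal0 (ideal_genP _).
  by rewrite addn0 -[leqRHS]card_ord max_card.
move=> kes zsupp dz; have ks : (k < size s)%N by rewrite -kes addnS ltnS leq_addr.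
set J := add_ideal I (take k s) in dz *.
have idJ : is_ideal J by exact: ideal_genP.
set J' := add_ideal I (take k.+1 s).
have JJ' f : J f -> J' f.
  apply: ideal_gen_min; first exact: ideal_genP.
  move=> g Hg; apply: mem_ideal_gen; case: Hg => [|gs]; [by left|right].
  by rewrite (take_nth 0) // mem_rcons inE gs orbT.
have J's f : J' (s`_k * f).
  rewrite mulrC; apply: idealM; first exact: ideal_genP.
  by apply: mem_ideal_gen; right; rewrite (take_nth 0) // mem_rcons inE eqxx.
have [c sE] := graded_maximal_idealE (maxs _ (mem_nth 0 ks)).
pose w A : S^o := \sum_j c j * kh j z A.
have dw A : kd w A = s`_k * z A - \sum_j c j * kh j (kd z) A.
  apply/eqP; rewrite eq_sym subr_eq kd_lincomb -big_split sE mulr_suml; apply/eqP.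
  by apply: eq_bigr => j _; rewrite -[LHS]mulrA -(kd_kh j z A) mulrDr.
have Jh A : J (\sum_j c j * kh j (kd z) A).
  by apply: ideal_sum => // j _; apply: idealM => //; apply: ideal_kh.
have [||A|v Jv] := IH k.+1 w; first by rewrite addSnnS.
- move=> A Ae; apply: big1 => j _; rewrite /kh; case: ifPn => jA; last by rewrite mulr0.
  by rewrite zsupp ?mulr0 //; rewrite (cardsD1 j) jA in Ae; rewrite addnS -addSn.
- by rewrite -/J' dw; apply: idealB; [exact: ideal_genP | exact: J's | apply: JJ'].
have /function_choice[u Ju] A : exists a, J (w A - kd v A - s`_k * a).
  by apply: add_ideal_rcons; rewrite -take_nth //; exact: Jv.
(* [u] is the quotient of [w - kd v] by the next element modulo J. Then that element times
   [z - kd u] lies in J, and regularity cancels it. *)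
exists u => A; apply: regs => //; rewrite -/J.
have du : s`_k * kd (u : _ -> S^o) A = kd w A - kd (fun D => w D - kd v D - s`_k * u D : S^o) A.
  rewrite !kdB kd_kd subr0 opprB addrC addrNK /kd mulr_sumr.
  by apply: eq_bigr => j _; rewrite !scale_regE mulrCA.
rewrite mulrBr du dw -addrA -opprD subKr.
by apply: idealD => //; exact: ideal_kd.
Qed.

End IdealLemmas.

(** * Linear resolutions *)

Section LinearResolution.
Variables (K : fieldType) (n : nat).
Local Notation S := {mpoly K[n]}.
Implicit Types (A D : {set 'I_n}).

(** Membership in the k-th power of the graded maximal ideal, read off the coefficients. *)
Definition order_ge k (p : S) := forall m, (mdeg m < k)%N -> p@_m = 0.

Lemma order_ge0 k : order_ge k 0. Proof. by move=> m _; rewrite mcoeff0. Qed.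

Lemma order_geD k p q : order_ge k p -> order_ge k q -> order_ge k (p + q).
Proof. by move=> kp kq m mk; rewrite mcoeffD kp // kq // addr0. Qed.

Lemma order_ge_sum k (T : Type) (r : seq T) (P : pred T) (F : T -> S) :
  (forall i, P i -> order_ge k (F i)) -> order_ge k (\sum_(i <- r | P i) F i).
Proof. by move=> kF; elim/big_ind: _ => //; [exact: order_ge0 | exact: order_geD]. Qed.

Lemma order_geM a b p q : order_ge a p -> order_ge b q -> order_ge (a + b) (p * q).
Proof.
move=> ap bq m mab; apply: memN_msupp_eq0; apply/negP => /msuppM_le/allpairsP[[m1 m2] /= [m1p m2q E]].
move: mab; rewrite E mdegD ltnNge leq_add // leqNgt.
  by apply: contraL m1p => /ap; rewrite mcoeff_msupp negbK => ->.
by apply: contraL m2q => /bq; rewrite mcoeff_msupp negbK => ->.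
Qed.

Lemma order_geMr k a p : order_ge k p -> order_ge k (a * p).
Proof. by move=> kp; rewrite -[k]add0n; apply: order_geM. Qed.

Lemma order_geX j : order_ge 1 ('X_j : S).
Proof. by move=> m; rewrite ltnS leqn0 mdeg_eq0 => /eqP ->; rewrite mcoeffX mnm1_eq0. Qed.

Lemma order_ge1 p : p@_0 = 0 -> order_ge 1 p.
Proof. by move=> p0 m; rewrite ltnS leqn0 mdeg_eq0 => /eqP ->. Qed.

Lemma order_ge_kd k (f : {set 'I_n} -> S^o) A :
  (forall D, order_ge k (f D)) -> order_ge k.+1 (kd f A).
Proof.
move=> kf; apply: order_ge_sum => j _; rewrite scale_regE -mulrA -add1n.
by apply: order_geMr; apply: order_geM; [exact: order_geX | exact: kf].
Qed.

Lemma kd_row r (f : {set 'I_n} -> 'rV[S]_r) A q :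
  kd f A 0 q = kd (fun D => f D 0 q : S^o) A.
Proof. by rewrite summxE; apply: eq_bigr => j _; rewrite mxE. Qed.

Lemma kd_mulmx r s (f : {set 'I_n} -> 'rV[S]_r) (M : 'M[S]_(r, s)) A :
  kd (fun D => f D *m M) A = kd f A *m M.
Proof. by rewrite mulmx_suml; apply: eq_bigr => j _; rewrite scalemxAl. Qed.

Lemma kd_row_exact r (f : {set 'I_n} -> 'rV[S]_r) :
  (forall A, kd f A = 0) -> (forall q, (f set0 0 q)@_0 = 0) ->
  exists g, forall A, f A = kd g A.
Proof.
move=> df0 f0; exists (fun A => \row_q kH (fun D => f D 0 q : S^o) A) => A.
apply/rowP => q; rewrite kd_row.
rewrite (eq_kd (g := kH (fun D => f D 0 q : S^o))) => [|D]; last by rewrite mxE.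
by rewrite kd_kH // => D; rewrite -kd_row df0 mxE.
Qed.

Definition drop_const r (v : 'rV[S]_r) : 'rV[S]_r := v - map_mx (fun p : S => (p@_0)%:MP) v.

Lemma order_drop_const r (v : 'rV[S]_r) q : order_ge 1 (drop_const v 0 q).
Proof. by apply: order_ge1; rewrite !mxE mcoeffB mcoeffC eqxx mulr1 subrr. Qed.

(** All entries of E have degree e, so the degree e part of [v *m E] comes from the constants of v
    alone; the order hypothesis makes it vanish. *)
Lemma drop_const_mulmx a b (E : 'M[S]_(a, b)) (v : 'rV_a) e :
  (forall p q m, m \in msupp (E p q) -> mdeg m = e) ->
  (forall q, order_ge e.+1 ((v *m E) 0 q)) -> drop_const v *m E = v *m E.
Proof.
move=> homE vE.
have E_order p q : order_ge e (E p q).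
  move=> m me; apply: memN_msupp_eq0; apply: contraL me => /homE ->.
  by rewrite ltnn.
rewrite mulmxBl -[RHS]subr0; congr (_ - _).
apply/rowP => q; rewrite [RHS]mxE; apply/mpolyP => m; rewrite mcoeff0.
have [me|me] := eqVneq (mdeg m) e; last first.
  rewrite mxE raddf_sum big1 // => p _; rewrite !mxE /= mcoeffCM.
  have -> : (E p q)@_m = 0 by apply: memN_msupp_eq0; apply: contra me => /homE ->.
  by rewrite mulr0.
have : (drop_const v *m E) 0 q = (v *m E) 0 q - (map_mx (fun p : S => (p@_0)%:MP) v *m E) 0 q.
  by rewrite mulmxBl !mxE.
move/(congr1 (fun p : S => p@_m)); rewrite mcoeffB (vE q) ?me // sub0r.
suff -> : ((drop_const v *m E) 0 q)@_m = 0 by move/eqP; rewrite eq_sym oppr_eq0 => /eqP.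
have : order_ge e.+1 ((drop_const v *m E) 0 q).
  rewrite mxE; apply: order_ge_sum => p _; rewrite -add1n.
  by apply: order_geM => //; exact: order_drop_const.
by apply; rewrite me.
Qed.

(** * Lifting Koszul cycles along a linear complex *)

Section Lift.
Variable (F : free_sequence K n).
Hypothesis exactF : forall i (v : 'rV_(rank F i.+1)), v *m differential F i = 0 <->
  exists w : 'rV_(rank F i.+2), v = w *m differential F i.+1.
Hypothesis linearF : forall i p q m, m \in msupp (differential F i p q) -> mdeg m = 1%N.

Lemma differential_order i (v : 'rV_(rank F i.+1)) q : order_ge 1 ((v *m differential F i) 0 q).
Proof.
rewrite mxE; apply: order_ge_sum => p _; apply: order_geMr => m m1.
by apply: memN_msupp_eq0; apply: contraL m1 => /linearF ->.
Qed.

(* Zigzag in the double complex Koszul (x) F. As the matrices of F are linear, only the vanishing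
   of the constant terms has to be carried along. *)
Lemma koszul_lift p i (z : {set 'I_n} -> 'rV_(rank F i)) (y : {set 'I_n} -> 'rV_(rank F i.+1)) :
  (forall A, (p <= #|A|)%N -> z A = 0) -> (forall A q, order_ge 1 (z A 0 q)) ->
  (forall A, kd z A = y A *m differential F i) ->
  exists w w', forall A, z A = kd w A + w' A *m differential F i.
Proof.
elim: p i z y => [|p IH] i z y zsupp z1 dz.
  exists (fun _ => 0), (fun _ => 0) => A.
  by rewrite zsupp // kd0 // mul0mx addr0.
(* On sets with at least p elements [kd z] vanishes, so [y] may be replaced by 0 there; elsewhere
   its constants contribute nothing because [kd z] has order 2 and the differential is linear. Thus
   [y'] meets the hypotheses on [z] one step further. *)
pose y' A := if (p <= #|A|)%N then 0 else drop_const (y A).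
have dz' A : kd z A = y' A *m differential F i.
  rewrite /y'; case: ifPn => pA.
    rewrite mul0mx; apply: big1 => j jA; rewrite zsupp ?scaler0 //.
    by rewrite cardsU1 jA add1n ltnS.
  rewrite (drop_const_mulmx (@linearF i)) => [|q]; rewrite -dz // kd_row.
  exact: order_ge_kd.
have /function_choice[y2 dy] A : exists w, kd y' A = w *m differential F i.+1.
  apply/exactF; rewrite -kd_mulmx (eq_kd (g := kd z)) ?kd_kd //.
have [A pA|A q||w [w' yE]] := IH i.+1 y' y2.
- by rewrite /y' pA.
- by rewrite /y'; case: ifP => _; [rewrite mxE; exact: order_ge0 | exact: order_drop_const].
- exact: dy.
(* The correction [w *m differential F i] turns z into a Koszul cycle: what remains of its boundary
   is a composite of two differentials of F. *)
have [|q|g gE] := @kd_row_exact _ (fun A => z A - w A *m differential F i).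
- move=> A; rewrite kdB kd_mulmx dz' yE mulmxDl addrC addKr.
  by apply/exactF; exists (w' A).
- rewrite !mxE mcoeffB (z1 _ _ 0%MM) ?mdeg0 // sub0r.
  by have := @differential_order i (w set0) q; rewrite mxE => -> //; rewrite ?mdeg0 ?oppr0.
by exists g, w => A; rewrite -gE subrK.
Qed.

End Lift.

(** * From the linear resolution to Koszul cycles of S/I *)

Section Quadratic.
Variable I : S -> Prop.
Hypothesis quadI : quadratic_monomial_ideal I.
Implicit Types (m : 'X_{1..n}) (i j : 'I_n).

Lemma quadratic_ideal : is_ideal I.
Proof.
case: quadI => G _ GI; have [I0 ID IM] := ideal_genP (fun g : S => exists2 m, G m & g = 'X_[m]).
split; first exact/GI; first by move=> f g /GI If /GI Ig; apply/GI/ID.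
by move=> a f /GI If; apply/GI/IM.
Qed.

Lemma mdeg2P m : mdeg m = 2%N -> exists i j, m = (U_(i) + U_(j))%MM.
Proof.
move=> m2; have /existsP[i mi] : [exists i, m i != 0%N].
  rewrite -negb_forall; apply/negP => /forallP m0; suff E : m = 0%MM by rewrite E mdeg0 in m2.
  by apply/mnmP => i; rewrite mnm0E; apply/eqP.
have mE : (m - U_(i) + U_(i))%MM = m by rewrite submK // lep1mP.
have /eqP/mdeg1P[j /eqP mj] : mdeg (m - U_(i)) = 1%N.
  by apply/eqP; rewrite -(eqn_add2r 1) -{1}(mdeg1 i) -mdegD mE m2.
by exists j, i; rewrite -mj mE.
Qed.

(** The polynomials all of whose monomials are divisible by a quadratic monomial of I form an ideal
    containing the generators. *)
Lemma quadratic_msupp f m : I f -> m \in msupp f ->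
  exists i j, (U_(i) + U_(j) <= m)%MM /\ I 'X_[U_(i) + U_(j)].
Proof.
case: quadI => G G2 GI /GI If mf.
pose Q m := exists i j, (U_(i) + U_(j) <= m)%MM /\ I 'X_[U_(i) + U_(j)].
move: m mf.
apply: (@ideal_gen_min _ _ (fun f : S => forall m, m \in msupp f -> Q m) _ _ _ _ If).
  split=> [m|p q Qp Qq m|a p Qp m]; first by rewrite msupp0.
    by move/msuppD_le; rewrite mem_cat => /orP[/Qp|/Qq].
  move=> /msuppM_le/allpairsP[[m1 m2] /= [_ /Qp[i [j [le Iij]]] ->]].
  exists i, j; split=> //; apply: lepm_trans le _; exact: lem_addl.
move=> _ [m Gm ->] m'; rewrite msuppX inE => /eqP ->.
have [i [j mE]] := mdeg2P (G2 _ Gm); exists i, j; rewrite mE lepm_refl; split=> //.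
by apply/GI/mem_ideal_gen; exists m; rewrite // mE.
Qed.

Lemma quadratic_monomial i j m : I 'X_[U_(i) + U_(j)] -> (U_(i) + U_(j) <= m)%MM -> I 'X_[m].
Proof.
by move=> Iij le; rewrite -(submK le) mpolyXD; apply: idealM => //; exact: quadratic_ideal.
Qed.

Lemma quadraticP f : I f <-> forall m, m \in msupp f -> I 'X_[m].
Proof.
split=> [If m /(quadratic_msupp If)[i [j [le Iij]]]|If]; first exact: quadratic_monomial Iij le.
rewrite [f]mpolyE big_seq; apply: ideal_sum => [|m /If Im]; first exact: quadratic_ideal.
by rewrite -mul_mpolyC; apply: idealM => //; exact: quadratic_ideal.
Qed.

Lemma quadratic_order f : I f -> order_ge 2 f.
Proof.
move=> If m m2; apply: memN_msupp_eq0; apply/negP => /(quadratic_msupp If)[i [j [le _]]].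
by move: m2; rewrite -(submK le) !mdegD !mdeg1 addnA addn1 addn1 ltnS ltnS ltn0.
Qed.

(** Lift [kd y] to F and apply the zigzag: this gives an I-valued chain with the same boundary as y.
    Subtracting it leaves a Koszul cycle over S, which is a boundary. *)
Lemma linear_resolution_koszul : linear_resolution I ->
  forall y : {set 'I_n} -> S^o, (forall A, order_ge 2 (y A)) -> (forall A, I (kd y A)) ->
  exists g : {set 'I_n} -> S^o, forall A, I (y A - kd g A).
Proof.
move=> [F [[augH difH [augE kerA exactF]] _ [t bettiF]]] y y2 Iy.
have idI := quadratic_ideal.
have shiftE k (p : 'I_(rank F k)) : shift p = k%:Z + t :> int.
  apply/eqP; apply/negPn/negP => ne.
  have := bettiF k (shift p - k%:Z); rewrite subr_eq addrC ne => /(_ isT)/eqP.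
  rewrite addrC subrK => /eqP/card0_eq/(_ p); by rewrite !inE eqxx.
have linF k p q m : m \in msupp (differential F k p q) -> mdeg m = 1%N.
  move/difH; rewrite !shiftE opprD addrACA subrr addr0 => /eqP.
  by rewrite -addn1 PoszD [_ + 1%:Z]addrC addrK => /eqP[].
(* If I is zero, y is already a cycle over S. Otherwise I contains a quadratic monomial, which gives
   t <= 2. *)
have [[f [If f0]]|noI] := classic (exists f, I f /\ f != 0); last first.
  have dy0 A : kd y A = 0.
    by apply/eqP/negPn/negP => ne; apply: noI; exists (kd y A).
  exists (kH y) => A; rewrite kd_kH // ?subrr; first exact: ideal0.
  by apply: y2; rewrite mdeg0.
have [m0 Im0 m02] : exists2 m, I 'X_[m] & mdeg m = 2%N.
  have [m mf] : exists m, m \in msupp f.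
    by case E: (msupp f) => [|m s]; [rewrite -msupp_eq0 E in f0 | exists m; rewrite inE eqxx].
  have [i [j [_ Iij]]] := quadratic_msupp If mf.
  by exists (U_(i) + U_(j))%MM; rewrite // mdegD !mdeg1.
(* The augmentation has entries homogeneous of degree t, and some monomial of one of them divides
   [m0]. *)
have [e e2 te] : exists2 e, (e <= 2)%N & t = e%:Z.
  have [v /matrixP/(_ 0 0)/(congr1 (fun p : S => p@_m0))] := (augE _).1 Im0.
  rewrite !mxE eqxx mulr1n mcoeffX eqxx => c1; apply: NNPP => H.
  suff c0 : (\sum_p v 0 p * augmentation F p 0)@_m0 = 0.
    by move/eqP: c1; rewrite c0 eq_sym oner_eq0.
  rewrite raddf_sum big1 // => p _.
  apply: memN_msupp_eq0; apply/negP => /msuppM_le/allpairsP[[m1 m2] /= [_ /augH m2t mE]].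
  by apply: H; exists (mdeg m2); rewrite ?m2t ?shiftE ?add0r // -m02 mE mdegD leq_addl.
have hom_aug p q m : m \in msupp (augmentation F p q) -> mdeg m = e.
  by rewrite ord1 => /augH; rewrite shiftE add0r te => -[].
have /function_choice[z zE] A : exists v : 'rV_(rank F 0), v *m augmentation F = (kd y A : S)%:M.
  exact/augE.
pose z1 A := drop_const (z A).
have z1E A : z1 A *m augmentation F = (kd y A : S)%:M.
  rewrite (drop_const_mulmx hom_aug) // => q; rewrite zE mxE ord1 eqxx mulr1n => m me.
  by apply: (order_ge_kd A y2); apply: leq_trans me _; rewrite ltnS.
have /function_choice[x xE] A : exists w, kd z1 A = w *m differential F 0.
  apply/kerA; rewrite -kd_mulmx; apply/matrixP => a b; rewrite !ord1 kd_row mxE.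
  by rewrite (eq_kd (g := kd y)) ?kd_kd // => D; rewrite z1E mxE eqxx mulr1n.
(* No subset has n + 1 elements, so the support condition is vacuous at [n.+1]. *)
have [A|A q|w [w' z1w]] := @koszul_lift _ exactF linF n.+1 0%N z1 x _ _ xE.
- by rewrite ltnNge -[leqRHS]card_ord max_card.
- exact: order_drop_const.
pose g1 A : S^o := (w A *m augmentation F) 0 0.
have Ig1 A : I (g1 A) by apply/augE; exists (w A); rewrite [LHS]mx11_scalar.
have dg1 A : kd g1 A = kd y A.
  rewrite -(kd_row (fun D => w D *m augmentation F)) kd_mulmx.
  have : kd y A = (z1 A *m augmentation F) 0 0 by rewrite z1E mxE eqxx mulr1n.
  have D0 : w' A *m differential F 0 *m augmentation F = 0 by apply/kerA; exists (w' A).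
  by rewrite z1w mulmxDl D0 addr0 => ->.
exists (kH (fun D => y D - g1 D)) => A; rewrite kd_kH.
- by rewrite subKr.
- by move=> D; rewrite kdB dg1 subrr.
by rewrite mcoeffB (y2 _ 0%MM) ?mdeg0 // (quadratic_order (Ig1 _)) ?mdeg0 ?subrr.
Qed.

End Quadratic.
End LinearResolution.

(** * The graph of a quadratic monomial ideal *)

Section Graph.
Variables (K : fieldType) (n : nat) (I : {mpoly K[n]} -> Prop).
Hypothesis quadI : quadratic_monomial_ideal I.
Local Notation S := {mpoly K[n]}.
Implicit Types (m : 'X_{1..n}) (i j k s t u v : 'I_n) (A B D W : {set 'I_n}).
Let idI : is_ideal I := quadratic_ideal quadI.

Definition adj i j : bool :=
  if excluded_middle_informative (I 'X_[U_(i) + U_(j)]) then false else true.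

Lemma adjP i j : reflect (~ I 'X_[U_(i) + U_(j)]) (adj i j).
Proof. by rewrite /adj; case: excluded_middle_informative => H; constructor. Qed.

Lemma adj_sym i j : adj i j = adj j i.
Proof. by rewrite /adj addmC. Qed.

Lemma adjNP i j : ~~ adj i j -> I 'X_[U_(i) + U_(j)].
Proof. by move=> /adjP/NNPP. Qed.

Lemma adjN_mul i j f : ~~ adj i j -> I ('X_i * ('X_j * f)).
Proof. by move=> /adjNP ?; rewrite mulrA mulrC -mpolyXD; exact: idealM. Qed.

Lemma mcoeff_adj i j f : adj i j -> I f -> f@_(U_(i) + U_(j)) = 0.
Proof.
move=> /adjP adjij /(quadraticP quadI) If; apply: memN_msupp_eq0; apply/negP.
by move/If.
Qed.

Definition kbasis (c : S) W : {set 'I_n} -> S^o := fun A => if A == W then c else 0.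

Lemma kd_kbasis (c : S) W D : (forall j, j \in W -> I ('X_j * c)) -> I (kd (kbasis c W) D).
Proof.
move=> Ic; apply: ideal_sum => // j jD; rewrite /kbasis; case: eqP => [E|_].
  by rewrite scale_regE -mulrA; apply: idealM => //; apply: Ic; rewrite -E setU11.
by rewrite scaler0; exact: ideal0.
Qed.

Lemma mcoeff_kd0 (g : {set 'I_n} -> S^o) D : (kd g D : S)@_0 = 0.
Proof. by rewrite mcoeff_kd big1 // => j; rewrite mnm0E andbF. Qed.

Lemma mcoeff_kd1 (g : {set 'I_n} -> S^o) D s : (kd g D : S)@_(U_(s)) =
  if s \in D then 0 else ksgn K s D * (g (s |: D) : S)@_0.
Proof.
rewrite mcoeff_kd; case: ifPn => sD.
  by apply: big1 => j /andP[jD]; rewrite mnm1E; case: (s =P j) jD => // <-; rewrite sD.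
rewrite (bigD1 s) /=; last by rewrite sD mnm1E eqxx.
rewrite big1 => [|j /andP[/andP[_]]]; last by rewrite mnm1E [s == j]eq_sym; case: (j == s).
have -> : (U_(s) - U_(s))%MM = 0%MM by apply/mnmP => l; rewrite mnmBE subnn mnm0E.
by rewrite addr0.
Qed.

Lemma mcoeff_kd2 (g : {set 'I_n} -> S^o) D s t : s != t ->
  (kd g D : S)@_(U_(s) + U_(t)) =
  (if s \in D then 0 else ksgn K s D * (g (s |: D) : S)@_(U_(t))) +
  (if t \in D then 0 else ksgn K t D * (g (t |: D) : S)@_(U_(s))).
Proof.
move=> st; rewrite mcoeff_kd.
have E j : ((U_(s) + U_(t))%MM j != 0%N) = (j == s) || (j == t).
  by rewrite mnmDE !mnm1E [j == s]eq_sym [j == t]eq_sym; case: (s == j); case: (t == j).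
under eq_bigl do rewrite E.
rewrite (bigID (pred1 s)) /=; congr (_ + _).
  case: ifPn => sD.
    by apply: big1 => j /andP[/andP[jD _] /eqP js]; rewrite js sD in jD.
  rewrite (big_pred1 s) => [|j] /=; last by case: eqP => [->|]; rewrite ?sD ?andbF.
  by rewrite addmC addmK.
case: ifPn => tD.
  apply: big1 => j /andP[/andP[jD jst] js]; rewrite (negPf js) in jst.
  by rewrite (eqP jst) tD in jD.
rewrite (big_pred1 t) => [|j] /=; last first.
  case: (j =P t) => [->|]; first by rewrite tD eq_sym st orbT.
  by rewrite orbF -andbA andbN andbF.
by rewrite addmK.
Qed.

(** * What linearity says about the graph *)

Section LinearConsequences.
Hypothesis linI : forall y : {set 'I_n} -> S^o, (forall A, order_ge 2 (y A)) ->
  (forall A, I (kd y A)) -> exists g : {set 'I_n} -> S^o, forall A, I (y A - kd g A).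

Lemma order_ge_X2 i j : order_ge 2 ('X_[U_(i) + U_(j)] : S).
Proof. by rewrite mpolyXD; exact: (order_geM (@order_geX K n i) (@order_geX K n j)). Qed.

Lemma order_ge_kbasis (k : nat) c W A : order_ge k c -> order_ge k (kbasis c W A).
Proof. by rewrite /kbasis; case: ifP => // _ _; exact: order_ge0. Qed.

(** If i and j were adjacent, x_i x_j e_{i,j} would be a cycle of S/I because x_i^2 and x_j^2 lie in
    I. A boundary has no x_i x_j at e_{i,j}, since [kd] only brings in variables outside the index
    set. *)
Lemma nonloop_indep i j : i != j -> ~~ adj i i -> ~~ adj j j -> ~~ adj i j.
Proof.
move=> ij ii jj; apply/negP => adjij.
have [|A|g gP] := linI (y := kbasis 'X_[U_(i) + U_(j)] [set i; j]).
- by move=> A; apply: order_ge_kbasis; exact: order_ge_X2.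
- apply: kd_kbasis => k; rewrite mpolyXD !inE => /orP[]/eqP ->; first exact: adjN_mul.
  by rewrite ['X_i * _]mulrC; exact: adjN_mul.
have := mcoeff_adj adjij (gP [set i; j]).
rewrite mcoeffB mcoeff_kd2 // !inE !eqxx orbT addr0 subr0 /kbasis eqxx mcoeffX eqxx.
by move/eqP; rewrite oner_eq0.
Qed.

(** If a and b were not adjacent, x_i x_a e_{i,b} would be a cycle. In a boundary, its coefficient
    and that of x_i x_b e_{i,a} are both, up to sign, the coefficient of x_i in g at {i,a,b}; but
    one is 1 and the other 0. *)
Lemma nonloop_simplicial i a b : ~~ adj i i -> a != b -> adj i a -> adj i b -> adj a b.
Proof.
move=> ii ab ia ib; case: (boolP (adj a b)) => // adjab; exfalso.
have ai : a != i by apply: contraNneq ii => E; rewrite -{2}E.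
have bi : b != i by apply: contraNneq ii => E; rewrite -{2}E.
have [|A|g gP] := linI (y := kbasis 'X_[U_(i) + U_(a)] [set i; b]).
- by move=> A; apply: order_ge_kbasis; exact: order_ge_X2.
- apply: kd_kbasis => k; rewrite mpolyXD !inE => /orP[]/eqP ->; first exact: adjN_mul.
  by rewrite ['X_i * _]mulrC; apply: adjN_mul; rewrite adj_sym.
have := mcoeff_adj ib (gP [set i; a]); have := mcoeff_adj ia (gP [set i; b]).
rewrite !mcoeffB !mcoeff_kd2 1?eq_sym // !inE !eqxx (negPf ai) (negPf bi) (negPf ab) /=.
rewrite [b == a]eq_sym (negPf ab) !add0r /kbasis eqxx mcoeffX eqxx ifN; last first.
  apply: contra ab => /eqP/setP/(_ a); rewrite !inE eqxx orbT (negPf ai) /= => <-.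
  by [].
have -> : b |: [set i; a] = a |: [set i; b] by rewrite setUCA [RHS]setUCA (setUC [set a]).
rewrite mcoeff0 sub0r => + /eqP; rewrite oppr_eq0 mulf_eq0.
rewrite /ksgn signr_eq0 /= => E1 /eqP E2; move/eqP: E1; rewrite E2 mulr0 subr0.
by rewrite oner_eq0.
Qed.

Definition kphi W (g : {set 'I_n} -> S^o) s : K := ksgn K s (W :\ s) * (g (W :\ s) : S)@_(U_(s)).

(** In the multidegree of W, a chain of homological degree |W| - 1 is a function on vertices, and
    [kd] is, up to sign, its coboundary on the edge st. *)
Lemma mcoeff_kd_pair W (g : {set 'I_n} -> S^o) s t : s != t -> s \in W -> t \in W ->
  (kd g (W :\ s :\ t) : S)@_(U_(s) + U_(t)) =
  ksgn K s (W :\ s :\ t) * ksgn K t (W :\ t) * (kphi W g t - kphi W g s).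
Proof.
move=> st sW tW; rewrite mcoeff_kd2 // !inE !eqxx andbF /=.
set D := W :\ s :\ t.
have sD : s |: D = W :\ t.
  apply/setP=> l; rewrite !inE; case: (l =P s) => [->|] //; by rewrite st sW.
have tD : t |: D = W :\ s.
  by apply/setP=> l; rewrite !inE; case: (l =P t) => [->|] //; rewrite eq_sym st tW.
rewrite sD tD mulrBr /kphi -mulrA [ksgn K t _ * (_ * _)]mulrA ksgn_sqr mul1r; congr (_ + _).
have := @ksgn_swap _ K s t D st; rewrite !inE !eqxx andbF => /(_ isT isT).
by rewrite sD tD => ->; rewrite mulNr opprK mulrA -[_ * _ * ksgn K s _]mulrA ksgn_sqr mulr1.
Qed.

(* If u and v were not adjacent, the function on edges equal to the coboundary of the indicator of
   u on the A side and to 0 on the B side would be a cocycle of the clique complex of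
   A :|: B :|: {u, v} that is not a coboundary. It is turned into a Koszul cycle [y] by
   truncating [kd psi], which represents the coboundary; [kphi] reads a Koszul chain of the
   next degree as a function on vertices. *)
Lemma minimal_separator_adj A B u v : u != v -> [disjoint A & B] ->
  u \notin A :|: B -> v \notin A :|: B -> (forall a b, a \in A -> b \in B -> ~~ adj a b) ->
  (forall D, D = A \/ D = B -> forall f : 'I_n -> K,
    (forall s t, s \in u |: (v |: D) -> t \in u |: (v |: D) -> s != t -> adj s t -> f s = f t) ->
    f u = f v) -> adj u v.
Proof.
move=> uv AB uAB vAB noAB conn; case: (boolP (adj u v)) => // adjuv; exfalso.
pose W := u |: (v |: (A :|: B)).
have uW : u \in W by rewrite !inE eqxx.
pose psi := kbasis (ksgn S u (W :\ u) * 'X_u) (W :\ u).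
(* For D = [W :\ s :\ t] the condition says that s and t lie in [u |: A], so [y] keeps the edges of
   that part only. *)
pose y D : S^o := if v |: B \subset D then kd psi D else 0.
have psi1 D : order_ge 1 (psi D) by apply: order_ge_kbasis; apply: order_geMr; exact: order_geX.
have y2 D : order_ge 2 (y D).
  by rewrite /y; case: ifP => _; [exact: order_ge_kd | exact: order_ge0].
have Iy D : I (kd y D).
  have [vBD|vBD] := boolP (v |: B \subset D).
    suff -> : kd y D = 0 by exact: ideal0.
    rewrite -(kd_kd psi D); apply: eq_bigr => j _; rewrite /y ifT //.
    exact: subset_trans vBD (subsetUr _ _).
  (* Truncation leaves only terms divisible by x_j x_k x_u with j in [v |: B] and k in A. They lie
     in I: for j = v because u and v are not adjacent, for j in B because j and k are not. *)
  apply: ideal_sum => // j jD; rewrite /y; case: ifPn => [vBjD|_]; last first.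
    by rewrite scaler0; exact: ideal0.
  have jvB : j \in v |: B.
    apply: contraR vBD => jvB; apply/subsetP => l lvB.
    have := subsetP vBjD l lvB; rewrite in_setU1 => /orP[/eqP lj|//].
    by rewrite -lj lvB in jvB.
  rewrite scale_regE -mulrA; apply: idealM => //; rewrite mulr_sumr.
  apply: ideal_sum => // k kD; rewrite /psi /kbasis; case: eqP => [E|_]; last first.
    by rewrite scaler0 mulr0; exact: ideal0.
  have kA : k \in A.
    have : k \in W :\ u by rewrite -E setU11.
    have : k \notin v |: B by apply: contra kD => /(subsetP vBjD).
    by rewrite !inE negb_or => /andP[/negPf -> /negPf ->]; rewrite orbF => /andP[/negPf ->].
  rewrite scale_regE [X in 'X_j * X]mulrACA ['X_j * _]mulrCA; apply: idealM => //.
  move: jvB; rewrite in_setU1 => /orP[/eqP ->|jB].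
    by rewrite ['X_k * _]mulrC; apply: adjN_mul; rewrite adj_sym.
  by apply: adjN_mul; rewrite adj_sym; exact: noAB.
have [g gP] := linI y2 Iy.
have rel s t : s != t -> s \in W -> t \in W -> adj s t ->
    kphi W g t - kphi W g s =
    if v |: B \subset W :\ s :\ t then kphi W psi t - kphi W psi s else 0.
  move=> st sW tW adjst; have := mcoeff_adj adjst (gP (W :\ s :\ t)).
  rewrite mcoeffB mcoeff_kd_pair // /y => /eqP; rewrite subr_eq0 eq_sym => /eqP.
  have e0 : ksgn K s (W :\ s :\ t) * ksgn K t (W :\ t) != 0.
    by rewrite mulf_neq0 // /ksgn signr_eq0.
  case: ifP => _; first by rewrite mcoeff_kd_pair // => /(mulfI e0).
  by rewrite mcoeff0 => /eqP; rewrite mulf_eq0 (negPf e0) => /eqP.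
have psiE s : s \in W -> kphi W psi s = (s == u)%:R.
  move=> sW; rewrite /kphi /psi /kbasis; case: (s =P u) => [->|su].
    by rewrite eqxx mcoeff_ksgnM mulrA ksgn_sqr mul1r mcoeffXU eqxx.
  rewrite ifN ?mcoeff0 ?mulr0 //; apply/eqP => /setP/(_ u).
  by rewrite !inE !eqxx /= andbT => /negbFE/eqP us; apply: su.
have vW : v \in W by rewrite !inE eqxx orbT.
have subW D : D = A \/ D = B -> {subset u |: (v |: D) <= W}.
  move=> DAB s; rewrite !inE => /orP[->//|/orP[->|sD]]; first by rewrite orbT.
  by case: DAB sD => ->->; rewrite !orbT.
have gB : kphi W g u = kphi W g v.
  apply: (conn B); first by right.
  move=> s t sB tB st adjst.
  have := rel s t st (subW _ (or_intror erefl) _ sB) (subW _ (or_intror erefl) _ tB) adjst.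
  rewrite ifN; first by move/eqP; rewrite subr_eq0 eq_sym => /eqP.
  apply/negP => /subsetP H; move: sB tB; rewrite !in_setU1.
  case: (s =P u) => [su|_] /=.
    case: (t =P u) => [tu|_] /=; first by rewrite su tu eqxx in st.
    by rewrite -in_setU1 => _ /H; rewrite !inE eqxx.
  by rewrite -in_setU1 => /H; rewrite !inE eqxx andbF.
(* An edge on this side dropped by the truncation has v as an end and not u, so [kphi W psi] is 0 at
   both its ends. *)
have gA : kphi W g u - kphi W psi u = kphi W g v - kphi W psi v.
  apply: (conn A (or_introl erefl) (fun s => kphi W g s - kphi W psi s)).
  move=> s t sA tA st adjst; have sW := subW _ (or_introl erefl) _ sA.
  have tW := subW _ (or_introl erefl) _ tA.
  have := rel s t st sW tW adjst; case: ifPn => [_ /eqP|vB /eqP].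
    rewrite subr_eq => /eqP ->; ring.
  rewrite subr_eq0 => /eqP ->; congr (_ - _); rewrite !psiE //.
  have stv : (s == v) || (t == v).
    apply: contraR vB; rewrite negb_or => /andP[sv tv]; apply/subsetP => l lvB.
    have lA : l \in A -> l = v.
      move=> lA; move: lvB; rewrite !inE => /orP[/eqP //|lB].
      by have := disjointFr AB lA; rewrite lB.
    have lu : l != u.
      move: lvB; rewrite in_setU1 => /orP[/eqP->|lB]; first by rewrite eq_sym.
      by apply: contraNneq uAB => <-; rewrite inE lB orbT.
    have lW : l \in W by move: lvB; rewrite !inE => /orP[]->; rewrite !orbT.
    rewrite 2!in_setD1 lW andbT; apply/andP; split; apply/eqP => E.
      move: tA tv; rewrite -E !inE (negPf lu) /= => /orP[->//|/lA ->]; by rewrite eqxx.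
    move: sA sv; rewrite -E !inE (negPf lu) /= => /orP[->//|/lA ->]; by rewrite eqxx.
  case/orP: stv => /eqP E.
    rewrite E [v == u]eq_sym (negPf uv); case: eqP => // tu.
    by move: adjst; rewrite E tu adj_sym (negPf adjuv).
  rewrite E [v == u]eq_sym (negPf uv); case: eqP => // su.
  by move: adjst; rewrite E su (negPf adjuv).
(* [gA] and [gB] differ by the value 1 of [kphi W psi] at u against 0 at v. *)
move: gA; rewrite !psiE // eqxx [v == u]eq_sym (negPf uv) gB subr0 => /eqP.
by rewrite subr_eq addrC -subr_eq subrr eq_sym oner_eq0.
Qed.

End LinearConsequences.

(** * Koszul cycles bounding the depth *)

Section DepthBounds.
Variable d : nat.
Hypothesis depthI : forall z : {set 'I_n} -> S^o, (forall A, (#|A| + d <= n)%N -> z A = 0) ->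
  (forall A, I (kd z A)) -> exists g : {set 'I_n} -> S^o, forall A, I (z A - kd g A).

(** For d > n the support condition is vacuous, so e_set0 would be a boundary modulo I; but
    boundaries and I have no constant term. *)
Lemma depth_le_dim : (d <= n)%N.
Proof.
rewrite leqNgt; apply/negP => nd; have [|A|g gP] := depthI (z := kbasis 1 set0).
- by move=> A; rewrite leqNgt (leq_trans nd) // leq_addl.
- by apply: kd_kbasis => k; rewrite inE.
have /(quadratic_order quadI)/(_ 0%MM) := gP set0.
rewrite mdeg0 mcoeffB mcoeff_kd0 /kbasis eqxx mcoeff1 eqxx subr0 => /(_ isT)/eqP.
by rewrite oner_eq0.
Qed.

(** Let N be the neighbourhood of i. Then x_i e_(~: N) is a cycle of degree n - |N|, and not a
    boundary modulo I: i itself is outside N, so no boundary has x_i there. *)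
Lemma depth_le_nonloop i : ~~ adj i i -> (d <= #|[set j | adj i j]|)%N.
Proof.
move=> ii; rewrite leqNgt; apply/negP => Nd; set N := [set j | adj i j] in Nd *.
have [|A|g gP] := depthI (z := kbasis 'X_i (~: N)).
- move=> A; rewrite /kbasis; case: eqP => // -> H.
  by move: Nd; rewrite -(ltn_add2l #|~: N|) addnC cardsC card_ord ltnNge H.
- by apply: kd_kbasis => k; rewrite !inE adj_sym -['X_i]mulr1; exact: adjN_mul.
have /(quadratic_order quadI)/(_ U_(i)%MM) := gP (~: N).
rewrite mdeg1 mcoeffB mcoeff_kd1 /kbasis eqxx mcoeffXU eqxx !inE ii subr0 => /(_ isT)/eqP.
by rewrite oner_eq0.
Qed.

(* Truncating the boundary of e_(A :|: B) to the A side gives a cycle because A and B are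
   disconnected; it represents the indicator of A. *)
Lemma depth_le_cut A B a b : a \in A -> b \in B -> [disjoint A & B] ->
  (forall s t, s \in A -> t \in B -> ~~ adj s t) -> (d <= #|~: (A :|: B)|.+1)%N.
Proof.
move=> aA bB AB noAB; rewrite leqNgt; apply/negP => Td.
pose W := A :|: B.
pose z D : S^o := if B \subset D then kd (kbasis 1 W) D else 0.
have [|D|g gP] := depthI (z := z).
- move=> D Dn; rewrite /z; case: ifP => // _; apply: big1 => j jD.
  rewrite /kbasis; case: eqP => [E|_]; last by rewrite scaler0.
  exfalso; move: Td; rewrite -/W -E ltnNge => /negP; apply.
  rewrite -(leq_add2l #|D|) (leq_trans Dn) // -{1}[n]card_ord -(cardsC (j |: D)).
  by rewrite cardsU1 jD addnS add1n.
- have [BD|BD] := boolP (B \subset D).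
    suff -> : kd z D = 0 by exact: ideal0.
    rewrite -(kd_kd (kbasis 1 W) D); apply: eq_bigr => j _; rewrite /z ifT //.
    exact: subset_trans BD (subsetUr _ _).
  apply: ideal_sum => // j jD; rewrite /z; case: ifPn => [BjD|_]; last first.
    by rewrite scaler0; exact: ideal0.
  have jB : j \in B.
    apply: contraR BD => jB; apply/subsetP => l lB.
    have := subsetP BjD l lB; rewrite in_setU1 => /orP[/eqP lj|//].
    by rewrite -lj lB in jB.
  rewrite scale_regE -mulrA; apply: idealM => //; rewrite mulr_sumr.
  apply: ideal_sum => // k kD; rewrite /kbasis; case: eqP => [E|_]; last first.
    by rewrite scaler0 mulr0; exact: ideal0.
  have kA : k \in A.
    have : k \in W by rewrite -E setU11.
    have : k \notin B by apply: contra kD => /(subsetP BjD).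
    by rewrite inE => /negPf ->; rewrite orbF.
  rewrite scale_regE -mulrA ['X_j * _]mulrCA; apply: idealM => //.
  by apply: adjN_mul; rewrite adj_sym; exact: noAB.
(* Compare the coefficients of x_s at [W :\ s]: the boundary always gives the constant term of
   [g W], whereas z gives 1 for s in A and 0 for s in B. *)
have gW s : s \in W -> (B \subset W :\ s)%:R = (g W : S)@_0.
  move=> sW; have /(quadratic_order quadI)/(_ U_(s)%MM) := gP (W :\ s).
  rewrite mdeg1 mcoeffB mcoeff_kd1 /z !inE eqxx /= setD1K // => /(_ isT)/eqP.
  rewrite subr_eq0; case: ifP => _.
    rewrite mcoeff_kd1 !inE eqxx /= setD1K // => /eqP; rewrite /kbasis eqxx mcoeff1 eqxx.
    by apply: mulfI; rewrite /ksgn signr_eq0.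
  by rewrite mcoeff0 eq_sym mulf_eq0 /ksgn signr_eq0 => /eqP.
have := gW a; rewrite -(gW b) !inE ?aA ?bB ?orbT // => /(_ isT)/eqP.
have -> : B \subset W :\ a by rewrite subsetD1 subsetUr (disjointFr AB aA).
have -> : (B \subset W :\ b) = false by rewrite subsetD1 bB andbF.
by rewrite oner_eq0.
Qed.

End DepthBounds.
End Graph.

(** * Cuts and simplicial vertices *)

Section Dirac.
Variables (T : finType) (e : rel T).
Hypothesis e_sym : forall s t, e s t = e t s.
Implicit Types (s t u v : T) (A B C U : {set T}).

Definition clique C := [forall s in C, forall t in C, (s != t) ==> e s t].

Lemma cliqueP C : reflect {in C &, forall s t, s != t -> e s t} (clique C).
Proof.
apply: (iffP forall_inP) => H s.
  by move=> t sC tC; have /forall_inP/(_ t tC)/implyP := H s sC.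
by move=> sC; apply/forall_inP => t tC; apply/implyP; exact: H.
Qed.

Lemma cliqueS C C' : C' \subset C -> clique C -> clique C'.
Proof.
by move=> /subsetP sub /cliqueP H; apply/cliqueP => s t /sub sC /sub tC; exact: H.
Qed.

(** The separator is the remainder [U :\: (A :|: B)], so a largest [A :|: B] means a smallest
    separator. *)
Definition cut U A B := [&& A :|: B \subset U, [disjoint A & B], A != set0, B != set0 &
  [forall s in A, forall t in B, ~~ e s t]].

Lemma cutP U A B : reflect [/\ A :|: B \subset U, [disjoint A & B], A != set0, B != set0 &
  {in A & B, forall s t, ~~ e s t}] (cut U A B).
Proof.
apply: (iffP and5P) => -[H1 H2 H3 H4 H5]; split=> //.
  by move=> s t sA tB; have /forall_inP := (forall_inP H5) s sA; apply.
by apply/forall_inP => s sA; apply/forall_inP => t; exact: H5.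
Qed.

Lemma cutC U A B : cut U A B = cut U B A.
Proof.
apply/cutP/cutP => -[H1 H2 H3 H4 H5]; split; rewrite // 1?setUC // 1?disjoint_sym //;
  by move=> s t sA tB; rewrite e_sym; exact: H5.
Qed.

(** For v in U, it contains v exactly when v carries a loop, which is when x_v^2 must be allowed in
    the box of v. *)
Definition nbhd U v := [set i in U | e v i].

Lemma disjointsU1 x A B : x \notin B -> [disjoint A & B] -> [disjoint x |: A & B].
Proof. by move=> xB AB; rewrite -setI_eq0 setIUl setU_eq0 !setI_eq0 disjoints1 xB. Qed.

(* In a maximal cut, a function on [u |: (v |: A)] that is constant along edges takes the same
   value at [u] and [v]: otherwise its level sets would give a larger cut. *)
Lemma maximal_cut_connected (R : eqType) U A B u v (f : T -> R) : cut U A B ->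
  (forall A' B', cut U A' B' -> (#|A' :|: B'| <= #|A :|: B|)%N) ->
  u \in U -> v \in U -> u \notin A :|: B -> v \notin A :|: B ->
  (forall s t, s \in u |: (v |: A) -> t \in u |: (v |: A) -> s != t -> e s t -> f s = f t) ->
  f u = f v.
Proof.
move=> /cutP[AB dAB A0 B0 eAB] maxAB uU vU uAB vAB fe; apply/eqP/negPn/negP => fuv.
have larger A' B' w : w \notin A :|: B -> A' :|: B' = w |: (A :|: B) -> cut U A' B' -> False.
  by move=> wAB E /maxAB; rewrite E cardsU1 wAB ltnn.
have AW : {subset A <= u |: (v |: A)} by move=> x xA; rewrite !inE xA !orbT.
have [[vA vB] [uA uB]] : (v \notin A /\ v \notin B) /\ (u \notin A /\ u \notin B).
  by move: uAB vAB; rewrite !inE !negb_or => /andP[-> ->] /andP[-> ->].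
have [A20|[w]] := set_0Vmem [set x in A | f x != f u].
  have fA x : x \in A -> f x = f u.
    by move=> xA; apply/eqP; move/setP/(_ x): A20; rewrite !inE xA /= => /negbFE.
  (* An edge from v to A would carry the value [f u] to v; so v has no neighbour in A and can join
     B. *)
  apply: (larger (v |: B) A v vAB); first by rewrite -setUA (setUC B).
  apply/cutP; split=> //.
  - by rewrite -setUA (setUC B) subUset sub1set vU.
  - by apply: disjointsU1 => //; rewrite disjoint_sym.
  - by apply/set0Pn; exists v; rewrite setU11.
  move=> s t; rewrite !inE => /orP[/eqP ->|sB] tA; last by rewrite e_sym; exact: eAB.
  apply/negP => vt; move/eqP: fuv; apply; rewrite -(fA t tA); apply: esym.
  by apply: fe => //; [rewrite !inE eqxx orbT | exact: AW | apply: contraNneq vA => ->].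
(* No edge joins the vertices of A at another level than u to the rest of A or to u, so u, B and
   that rest form one side against [A2]. *)
set A2 := [set x in A | f x != f u] => wA2.
have A2A : {subset A2 <= A} by move=> x; rewrite inE => /andP[].
have AE : u |: (B :|: A :\: A2) :|: A2 = u |: (A :|: B).
  by apply/setP => x; rewrite !inE; case: (x == u); case: (x \in A); case: (x \in B); case: (f x == f u).
apply: (larger _ A2 u uAB AE); apply/cutP; split.
- by rewrite AE subUset sub1set uU.
- apply: disjointsU1; first by apply: contra uA => /A2A.
  rewrite disjoint_subset; apply/subsetP => x; rewrite !inE => /orP[xB|/andP[H _]] //.
  by rewrite (disjointFl dAB xB).
- by apply/set0Pn; exists u; rewrite setU11.
- by apply/set0Pn; exists w.
move=> s t sB tA2; have tA := A2A t tA2; have ft : f t != f u by move: tA2; rewrite inE tA.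
have ut : u != t by apply: contraNneq uA => ->.
move: sB; rewrite !inE => /or3P[/eqP ->|sB|/andP[H sA]].
- by apply: contra ft => ut'; apply/eqP/esym/fe => //; [rewrite !inE eqxx | exact: AW].
- by rewrite e_sym; exact: eAB.
move: H; rewrite sA /= negbK => /eqP fs; apply: contra ft => st; rewrite -fs eq_sym; apply/eqP.
by apply: fe => //; [exact: AW|exact: AW|apply: contra_neq ut => E; move: tA2; rewrite -E inE sA fs eqxx].
Qed.

Section CliqueCuts.
Variable V : {set T}.
Hypothesis clique_cut : forall U, ~~ clique U -> exists A B, cut U A B /\ clique (U :\: (A :|: B)).

(** Dirac's argument. The clique C misses one side of a clique cut, say B. Induction on [U :\: A]
    with the separator as the clique to avoid gives v in B, whose neighbours in U all avoid A. *)
Lemma exists_simplicial U C : clique C -> C \proper U ->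
  exists2 v, v \in U :\: C & clique (nbhd U v).
Proof.
have [k] := ubnP #|U|; elim: k U C => // k IH U C Uk cC CU.
have [cU|ncU] := boolP (clique U).
  have [_ [v vU vC]] := properP CU; exists v; first by rewrite inE vU vC.
  by apply: cliqueS cU; apply/subsetP => x; rewrite inE => /andP[].
have [A [B [cAB cS]]] := clique_cut ncU.
wlog CB : A B cAB cS / [disjoint C & B].
  move=> H; have [CB|] := boolP [disjoint C & B]; first exact: (H A B).
  rewrite -setI_eq0 => /set0Pn[b]; rewrite inE => /andP[bC bB].
  apply: (H B A); rewrite 1?cutC // 1?setUC //.
  rewrite disjoint_subset; apply/subsetP => a aC; rewrite !inE; apply/negP => aA.
  have [_ dAB _ _ eAB] := cutP _ _ _ cAB.
  have := eAB a b aA bB; have /cliqueP -> // := cC.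
  by apply: contraTneq aA => ->; rewrite (disjointFl dAB bB).
have [ABU dAB A0 B0 eAB] := cutP _ _ _ cAB.
have BU : B \subset U := subset_trans (subsetUr _ _) ABU.
have [||v vB cv] := IH (U :\: A) (U :\: (A :|: B)) _ cS.
- rewrite (leq_trans _ (Uk : (_ <= k)%N)) //; apply: proper_card.
  have [a aA] := set0Pn _ A0; apply/properP; split; first exact: subsetDl.
  by exists a; rewrite ?inE ?aA // (subsetP ABU) // inE aA.
- have [b bB] := set0Pn _ B0; apply/properP; split; first by apply: setDS; exact: subsetUl.
  by exists b; rewrite !inE ?bB ?orbT // (subsetP BU) // (disjointFl dAB bB).
have {}vB : v \in B.
  by move: vB; rewrite !inE; case: (v \in A); case: (v \in B); case: (v \in U).
exists v; first by rewrite inE (subsetP BU) // (disjointFl CB vB).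
apply: cliqueS cv; apply/subsetP => x; rewrite !inE => /andP[xU vx].
rewrite xU vx !andbT; apply/negP => xA; have := eAB x v xA vB.
by rewrite e_sym vx.
Qed.

End CliqueCuts.

Lemma exists_maximal_cut U : ~~ clique U -> exists A B, cut U A B /\
  forall A' B', cut U A' B' -> (#|A' :|: B'| <= #|A :|: B|)%N.
Proof.
case/forall_inPn => s sU /forall_inPn[t tU]; rewrite negb_imply => /andP[st est].
have cst : cut U [set s] [set t].
  apply/cutP; split; rewrite ?subUset ?sub1set ?sU //.
  - by rewrite disjoints1 inE.
  - by apply/set0Pn; exists s; rewrite inE.
  - by apply/set0Pn; exists t; rewrite inE.
  by move=> x y; rewrite !inE => /eqP -> /eqP ->.
case: (@arg_maxnP _ ([set s], [set t]) (fun p => cut U p.1 p.2) (fun p => #|p.1 :|: p.2|)) => //.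
by case=> A B cAB maxAB; exists A, B; split=> // A' B' /(maxAB (A', B')).
Qed.

(** The neighbours of a simplicial v cannot meet both sides, so v joins a side and the separator is
    unchanged. Bounds on separators thus survive the removal of v. *)
Lemma cut_extend U A B v : v \in U -> clique (nbhd U v) -> cut (U :\ v) A B ->
  cut U (v |: A) B \/ cut U A (v |: B).
Proof.
move=> vU cv /cutP[AB dAB A0 B0 eAB].
have ABU : v |: (A :|: B) \subset U.
  by rewrite subUset sub1set vU (subset_trans AB) // subsetDl.
have vAB : v \notin A :|: B by apply/negP => /(subsetP AB); rewrite !inE eqxx.
have [vA vB] : v \notin A /\ v \notin B by move: vAB; rewrite inE negb_or => /andP.
have [/existsP[t /andP[tB vt]]|H] := boolP [exists t in B, e v t].
  right; apply/cutP; split; rewrite // 1?setUCA //.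
  - by rewrite disjoint_sym; apply: disjointsU1 => //; rewrite disjoint_sym.
  - by apply/set0Pn; exists v; rewrite setU11.
  move=> a b aA; rewrite !inE => /orP[/eqP ->|bB]; last exact: eAB.
  apply/negP => av; have := eAB a t aA tB; have /cliqueP -> // := cv.
  - by rewrite inE e_sym av andbT (subsetP ABU) // !inE aA orbT.
  - by rewrite inE vt andbT (subsetP ABU) // !inE tB !orbT.
  by apply: contraTneq aA => ->; rewrite (disjointFl dAB tB).
left; apply/cutP; split; rewrite // -?setUA //.
- exact: disjointsU1.
- by apply/set0Pn; exists v; rewrite setU11.
move=> a b; rewrite !inE => /orP[/eqP ->|aA] bB; last exact: eAB.
by apply: contra H => vb; apply/existsP; exists b; rewrite bB.
Qed.

End Dirac.

(** * Stanley decompositions *)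

Section Boxes.
Variables (n : nat) (e : rel 'I_n).
Hypothesis e_sym : forall s t, e s t = e t s.
Implicit Types (i j s t v : 'I_n) (m : 'X_{1..n}) (U Z : {set 'I_n}).

Definition standard m := [forall i, forall j, (U_(i) + U_(j) <= m)%MM ==> e i j].
Definition supported U m := [forall i, (m i != 0%N) ==> (i \in U)].
Definition in_box m (b : 'X_{1..n} * {set 'I_n}) := (b.1 <= m)%MM && supported b.2 (m - b.1)%MM.

Lemma supportedP U m : reflect (forall i, m i != 0%N -> i \in U) (supported U m).
Proof. by apply: (iffP forallP) => H i; apply/implyP/H. Qed.

Lemma lep_pair i j m : (U_(i) + U_(j) <= m)%MM = [&& m i != 0%N, m j != 0%N & (i == j) ==> (1 < m i)%N].
Proof.
apply/mnm_lepP/and3P => [H|[mi mj mij] l]; last first.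
  rewrite mnmDE !mnm1E; case: (i =P l) => [<-|_]; last first.
    by case: (j =P l) => [<-|_] //=; rewrite add0n lt0n.
  by rewrite [j == i]eq_sym; case: (i == j) mij => /= H; rewrite ?H // addn0 lt0n.
have := H i; have := H j; rewrite !mnmDE !mnm1E !eqxx => Hj Hi; split.
- by rewrite -lt0n (leq_trans _ Hi).
- by rewrite -lt0n (leq_trans _ Hj) // addn1.
by apply/implyP => /eqP ij; move: Hi; rewrite ij eqxx.
Qed.

Lemma standardP m : reflect ((forall i j, i != j -> m i != 0%N -> m j != 0%N -> e i j) /\
  (forall i, (1 < m i)%N -> e i i)) (standard m).
Proof.
apply: (iffP forallP) => [H|[H1 H2] i].
  split=> [i j ij mi mj|i mi]; last first.
    have /forallP/(_ i)/implyP := H i; apply; rewrite lep_pair mi implybT -lt0n.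
    by rewrite (ltn_trans _ mi).
  by have /forallP/(_ j)/implyP := H i; apply; rewrite lep_pair mi mj (negPf ij).
apply/forallP => j; apply/implyP; rewrite lep_pair => /and3P[mi mj].
have [<- /= /H2 //|ij _] := eqVneq i j; exact: H1.
Qed.

(** In a standard multiple of x_v all other variables are neighbours of v. Conversely these are
    pairwise adjacent and carry loops, so any product of them is allowed. *)
Lemma in_box_simplicial U v m : v \in U -> clique e (nbhd e U v) ->
  (forall i, i \in nbhd e U v -> i != v -> e i i) ->
  in_box m (U_(v)%MM, nbhd e U v) = [&& standard m, supported U m & m v != 0%N].
Proof.
move=> vU /cliqueP cv loops; rewrite /in_box /= lep1mP.
have [mv|] := boolP (m v != 0%N); rewrite ?andbF ?andbT //=.
have mvE i : i != v -> (m - U_(v))%MM i = m i.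
  by move=> iv; rewrite mnmBE mnm1E eq_sym (negPf iv) subn0.
apply/supportedP/andP => [H|[/standardP[H1 H2] /supportedP H3] i].
  have nb i : m i != 0%N -> i != v -> i \in nbhd e U v by move=> mi iv; apply: H; rewrite mvE.
  split; last first.
    apply/supportedP => i mi; have [->//|/(nb i mi)] := eqVneq i v.
    by rewrite inE => /andP[].
  apply/standardP; split=> [i j ij mi mj|i mi].
    have [iv|iv] := eqVneq i v.
      by have := nb j mj; rewrite -iv eq_sym ij inE => /(_ isT)/andP[].
    have [jv|jv] := eqVneq j v; last by apply: cv => //; exact: nb.
    by have := nb i mi iv; rewrite inE jv e_sym => /andP[].
  have mi0 : m i != 0%N by rewrite -lt0n (ltn_trans _ mi).
  have [iv|iv] := eqVneq i v; last by apply: loops => //; exact: nb.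
  have : i \in nbhd e U v by apply: H; rewrite iv mnmBE mnm1E eqxx subn_eq0 -ltnNge -iv.
  by rewrite inE iv => /andP[].
have [->|iv] := eqVneq i v.
  by rewrite mnmBE mnm1E eqxx subn_eq0 -ltnNge => /H2; rewrite inE vU.
by rewrite mvE // => mi; rewrite inE H3 //= H1 // eq_sym.
Qed.

Variable d : nat.
Hypothesis indep : forall i j, i != j -> ~~ e i i -> ~~ e j j -> ~~ e i j.
Hypothesis simp : forall i s t, ~~ e i i -> s != t -> e i s -> e i t -> e s t.
Hypothesis clique_cut : forall U, ~~ clique e U ->
  exists A B, cut e U A B /\ clique e (U :\: (A :|: B)).

Lemma box_partition U : (d <= #|U|)%N ->
  (forall A B, cut e U A B -> (d <= #|U :\: (A :|: B)|.+1)%N) ->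
  (forall i, i \in U -> ~~ e i i -> (d <= #|nbhd e U i|)%N) ->
  exists bs : seq ('X_{1..n} * {set 'I_n}), (forall b, b \in bs -> (d <= #|b.2|)%N) /\
    forall m, count (in_box m) bs = standard m && supported U m.
Proof.
have [k] := ubnP #|U|; elim: k U => // k IH U Uk dU dcut dloop.
(* Standard monomials on U divisible by x_v form one box; the others live on [U :\ v], where
   [cut_extend] preserves the cut bound. *)
have step v : v \in U -> clique e (nbhd e U v) ->
    (forall i, i \in nbhd e U v -> i != v -> e i i) -> (d <= #|nbhd e U v|)%N ->
    (d <= #|U :\ v|)%N -> (forall i, i \in U :\ v -> ~~ e i i -> (d <= #|nbhd e (U :\ v) i|)%N) ->
    exists bs : seq ('X_{1..n} * {set 'I_n}), (forall b, b \in bs -> (d <= #|b.2|)%N) /\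
      forall m, count (in_box m) bs = standard m && supported U m.
  move=> vU cv loops dnb dUv dloopv.
  have [||bs [dbs bsP]] := IH (U :\ v) _ dUv _ dloopv.
  - by move: Uk; rewrite (cardsD1 v) vU.
  - move=> A B cAB.
    have UE : U :\ v :\: (A :|: B) = U :\: (v |: (A :|: B)) by rewrite setDDl.
    rewrite UE; have [/dcut|/dcut] := cut_extend e_sym vU cv cAB; first by rewrite setUA.
    by rewrite setUCA.
  exists ((U_(v)%MM, nbhd e U v) :: bs); split=> [b|m].
    by rewrite inE => /orP[/eqP ->|/dbs].
  rewrite /= in_box_simplicial // bsP; case: (standard m) => //=.
  have -> : supported (U :\ v) m = supported U m && (m v == 0%N).
    apply/supportedP/andP => [H|[/supportedP H mv] i mi].
      split; last by apply/negPn/negP => /H; rewrite !inE eqxx.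
      by apply/supportedP => i /H; rewrite inE => /andP[].
    by rewrite !inE H // andbT; apply: contraNneq mi => ->.
  by case: (supported U m); case: (m v == 0%N).
have [/existsP[v /andP[vU vv]]|noloop] := boolP [exists v in U, ~~ e v v].
  have vnb : v \notin nbhd e U v by rewrite inE (negPf vv) andbF.
  have nbUv : nbhd e U v \subset U :\ v.
    by rewrite subsetD1 vnb andbT; apply/subsetP => x; rewrite inE => /andP[].
  apply: (step v) => //.
  - by apply/cliqueP => s t; rewrite !inE => /andP[_ vs] /andP[_ vt] st; exact: (simp vv).
  - move=> i; rewrite inE => /andP[_ vi] iv; apply: contraTT vi => ii.
    by apply: indep => //; rewrite eq_sym.
  - exact: dloop.
  - exact: leq_trans (dloop _ vU vv) (subset_leq_card nbUv).
  (* Vertices without loop are independent, so removing v does not lower the degree of another such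
     vertex. *)
  move=> i; rewrite !inE => /andP[iv iU] ii; rewrite (leq_trans (dloop i iU ii)) //.
  apply/subset_leq_card/subsetP => x; rewrite !inE => /andP[-> ix]; rewrite ix !andbT.
  by apply: contraTneq ix => ->; apply: indep.
have loops i : i \in U -> e i i.
  by move=> iU; move: noloop; rewrite negb_exists => /forallP/(_ i); rewrite iU negbK.
have [cU|ncU] := boolP (clique e U).
  exists [:: (0%MM, U)]; split=> [b|m]; first by rewrite mem_seq1 => /eqP ->.
  have -> : count (in_box m) [:: (0%MM, U)] = supported U m.
    rewrite /= addn0 /in_box /= subm0 (_ : (0 <= m)%MM) //.
    by apply/mnm_lepP => i; rewrite mnm0E.
  rewrite andb_idl // => /supportedP mU; apply/standardP; split=> [i j ij mi mj|i mi].
    by move/cliqueP: cU; apply=> //; exact: mU.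
  by apply/loops/mU; rewrite -lt0n (ltn_trans _ mi).
have [||v] := @exists_simplicial _ e e_sym clique_cut U set0.
- by apply/cliqueP => s t; rewrite inE.
- rewrite proper0; apply: contraNneq ncU => ->; by apply/cliqueP => s t; rewrite inE.
rewrite setD0 => vU cv.
have nbU : nbhd e U v \subset U by apply/subsetP => x; rewrite inE => /andP[].
have vnb : v \in nbhd e U v by rewrite inE vU loops.
have [x xU xnb] : exists2 x, x \in U & x \notin nbhd e U v.
  by apply/subsetPn; apply: contra ncU => sub; apply: cliqueS cv.
have dnb : (d <= #|nbhd e U v|)%N.
  rewrite (cardsD1 v) vnb add1n.
  (* The other neighbours of v separate it from the non-neighbours; the extra 1 in the cut bound
     accounts for v itself, which has a loop. *)
  have /dcut : cut e U [set v] (U :\: nbhd e U v).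
    apply/cutP; split.
    - by rewrite subUset sub1set vU subsetDl.
    - by rewrite disjoints1 inE vnb.
    - by apply/set0Pn; exists v; rewrite inE.
    - by apply/set0Pn; exists x; rewrite inE xnb.
    by move=> s t; rewrite !inE => /eqP -> /andP[]; case: (t \in U); rewrite ?andbT.
  by rewrite setUC -setDDl setDDr setDv set0U (setIidPr nbU).
apply: (step v) => //.
- by move=> i; rewrite inE => /andP[iU _] _; exact: loops.
- have : nbhd e U v \proper U by apply/properP; split=> //; exists x.
  move/proper_card; rewrite (cardsD1 v U) vU add1n ltnS; exact: leq_trans.
by move=> i; rewrite inE => /andP[_ iU]; rewrite loops.
Qed.

End Boxes.

(** * From boxes to a Stanley decomposition, and the conclusion *)

Section Main.
Variables (K : fieldType) (n : nat).
Local Notation S := {mpoly K[n]}.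
Implicit Types (m : 'X_{1..n}) (I : S -> Prop) (A : {set 'I_n}).

(** Justifies the choice in [greatest]; depth and Stanley depth are both taken over nonempty sets of
    numbers bounded by n. *)
Lemma greatestP (P : nat -> Prop) b : (exists k, P k) -> (forall k, P k -> (k <= b)%N) ->
  P (greatest P) /\ forall k, P k -> (k <= greatest P)%N.
Proof.
move=> [k0 Pk0] Pb; apply: (epsilon_spec (inhabits 0%N) (fun d => P d /\ forall k, P k -> (k <= d)%N)).
pose p k : bool := if excluded_middle_informative (P k) then true else false.
have pP k : reflect (P k) (p k) by rewrite /p; case: excluded_middle_informative => H; constructor.
have ex_p : exists k, p k by exists k0; apply/pP.
have ub_p k : p k -> (k <= b)%N by move/pP/Pb.
case: (ex_maxnP ex_p ub_p) => k /pP Pk kmax; exists k; split=> // l /pP; exact: kmax.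
Qed.

Lemma standard_monomialP I (quadI : quadratic_monomial_ideal I) m :
  reflect (~ I 'X_[m]) (standard (adj I) m).
Proof.
apply: (iffP forallP) => [H Im|Im i].
  have [|i [j [le Iij]]] := quadratic_msupp quadI Im (m := m); first by rewrite msuppX inE.
  by have /forallP/(_ j) := H i; rewrite le => /adjP.
apply/forallP => j; apply/implyP => le; apply/adjP => Iij; apply: Im.
exact: (quadratic_monomial quadI Iij le).
Qed.

Section StanleyBoxes.
Variables (I : S -> Prop) (bs : seq ('X_{1..n} * {set 'I_n})).
Hypothesis quadI : quadratic_monomial_ideal I.
Hypothesis bsP : forall m, count (in_box m) bs = standard (adj I) m.

Let box (k : 'I_(size bs)) := nth (0%MM, set0) bs k.

Definition box_family : stanley_family K n :=
  @StanleyFamily K n (size bs) (fun k => 'X_[(box k).1]) (fun k => (box k).2).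

Lemma in_box_standard k m : in_box m (box k) -> standard (adj I) m.
Proof.
move=> mk; have : has (in_box m) bs by apply/(has_nthP (0%MM, set0)); exists k.
by rewrite has_count bsP; case: standard.
Qed.

Lemma in_box_inj k l m : in_box m (box k) -> in_box m (box l) -> k = l.
Proof.
move=> mk ml; apply/eqP/negPn/negP => kl.
have : (\sum_(i < size bs) in_box m (box i) <= 1)%N.
  have -> : (\sum_(i < size bs) in_box m (box i) = count (in_box m) bs)%N.
    rewrite -sum1_count [RHS]big_mkcond [RHS](big_nth (0%MM, set0)) [RHS]big_mkord.
    by apply: eq_bigr => i _; rewrite /box; case: in_box.
  by rewrite bsP; case: standard.
by rewrite (bigD1 k) //= (bigD1 l) 1?eq_sym //= mk ml.
Qed.

Lemma standard_in_box m : standard (adj I) m -> exists k, in_box m (box k).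
Proof.
move=> sm; have : has (in_box m) bs by rewrite has_count bsP sm.
by case/(has_nthP (0%MM, set0)) => i ibs mi; exists (Ordinal ibs).
Qed.

Lemma msupp_box k (v : S) m : in_subring (box k).2 v -> m \in msupp ('X_[(box k).1] * v) ->
  in_box m (box k).
Proof.
move=> vZ; rewrite mulrC (perm_mem (msuppMX _ _)) => /mapP[m' m'v ->].
rewrite /in_box lem_addr addmC addmK /=; apply/supportedP => i; exact: vZ.
Qed.

Lemma mcoeff_ideal f m : I f -> standard (adj I) m -> f@_m = 0.
Proof.
move=> If /(standard_monomialP quadI) sm; apply: memN_msupp_eq0; apply/negP => mf.
by apply: sm; move: m mf; apply/(quadraticP quadI).
Qed.

Lemma mcoeff_box_sum k (v : 'I_(size bs) -> S) m : (forall l, in_subring (box l).2 (v l)) ->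
  in_box m (box k) -> (\sum_l 'X_[(box l).1] * v l)@_m = ('X_[(box k).1] * v k)@_m.
Proof.
move=> vZ mk; rewrite (bigD1 k) //= mcoeffD raddf_sum /= big1 ?addr0 // => l lk.
apply: memN_msupp_eq0; apply: contraNN lk => /(msupp_box (vZ l)) ml.
by rewrite (in_box_inj mk ml).
Qed.

(** The monomials outside I are a basis of S/I, and every one lies in exactly one box. *)
Lemma box_family_stanley : stanley_decomposition I box_family.
Proof.
have zero k (v : S) : in_subring (box k).2 v -> (forall m, in_box m (box k) -> ('X_[(box k).1] * v)@_m = 0) ->
    'X_[(box k).1] * v = 0.
  move=> vZ H; apply/mpolyP => m; rewrite mcoeff0.
  have [mv|] := boolP (m \in msupp ('X_[(box k).1] * v)); last exact: memN_msupp_eq0.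
  exact/H/(msupp_box vZ).
split=> [k|f|v vZ Iv k].
- split; first by exists 1, (box k).1; rewrite scale1r.
  move=> v vZ Iv; have /eqP : 'X_[(box k).1] * v = 0.
    by apply: zero vZ _ => m mk; apply: mcoeff_ideal Iv _; exact: in_box_standard mk.
  rewrite mulf_eq0 => /orP[/eqP X0|/eqP//].
  have := congr1 (mcoeff (box k).1) X0; rewrite mcoeffX eqxx mcoeff0 => /eqP.
  by rewrite oner_eq0.
- pose v k := mdivX (fun m => in_box m (box k)) (box k).1 f.
  have vZ k : in_subring (box k).2 (v k).
    move=> m; rewrite mcoeff_msupp mcoeff_mdivX; case: ifP => [|_]; last by rewrite eqxx.
    by rewrite /in_box addmK => /andP[_ /supportedP H] _.
  exists v; first exact: vZ.
  apply/(quadraticP quadI) => m; rewrite mcoeff_msupp mcoeffB subr_eq0 => mf.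
  apply: NNPP => /(standard_monomialP quadI)/standard_in_box[k mk].
  move/eqP: mf; apply; rewrite (mcoeff_box_sum vZ mk).
  have bm : ((box k).1 <= m)%MM by case/andP: mk.
  by rewrite mulrC -{2}(submK bm) [(_ + (box k).1)%MM]addmC mcoeffMX mcoeff_mdivX submK // mk.
suff -> : gen k * v k = 0 by exact: ideal0 (quadratic_ideal quadI).
apply: zero (vZ k) _ => m mk; rewrite -(mcoeff_box_sum vZ mk).
by apply: mcoeff_ideal Iv _; exact: in_box_standard mk.
Qed.

End StanleyBoxes.

End Main.

Theorem corollary2p9 (K : fieldType) (n : nat) (I : {mpoly K[n]} -> Prop)
  (quadI : quadratic_monomial_ideal I) (linI : linear_resolution I) :
  (depth I <= sdepth I)%N.
Proof.
have idI := quadratic_ideal quadI.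
have addI0 f : add_ideal I (take 0 [::]) f <-> I f.
  split; last by move=> If; apply: mem_ideal_gen; left.
  by apply: ideal_gen_min => // g [].
(* The case k = 0: nothing is factored out yet, and all of s remains. *)
have koszul (s : seq {mpoly K[n]}) : (forall f, f \in s -> graded_maximal_ideal f) -> regular_sequence I s ->
  forall z : {set 'I_n} -> {mpoly K[n]}^o, (forall A : {set 'I_n}, (#|A| + size s <= n)%N -> z A = 0) ->
  (forall A, I (kd z A)) -> exists g : {set 'I_n} -> {mpoly K[n]}^o, forall A, I (z A - kd g A).
  move=> maxs regs z zs Iz.
  have [//|A|g gP] := regular_sequence_koszul maxs regs (k := 0%N) (z := z) _ zs.
    by rewrite take0; apply/addI0.
  by exists g => A; apply/addI0; have := gP A; rewrite !take0.
pose P d := exists s : seq {mpoly K[n]},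
    [/\ size s = d, forall f, f \in s -> graded_maximal_ideal f & regular_sequence I s].
(* The depth is attained by some s: the empty sequence is regular as 1 is not in I, and lengths are
   at most n. *)
have [||[s [sd maxs regs]] _] := @greatestP P n.
- exists 0%N, [::]; split=> //; split=> // /addI0 I1.
  have := quadratic_order quadI I1 (m := 0%MM); rewrite mdeg0 mcoeff1 eqxx => /(_ isT)/eqP.
  by rewrite oner_eq0.
- by move=> _ [s [<- maxs regs]]; exact: (depth_le_dim quadI (koszul s maxs regs)).
rewrite -[depth I]/(greatest P) -sd.
have {}koszul := koszul s maxs regs.
have linK := linear_resolution_koszul quadI linI.
have asym := adj_sym I.
(* On either side of a largest cut, functions constant along edges agree at u and v; linearity then
   makes the separator a clique. *)
have clique_cut U : ~~ clique (adj I) U ->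
    exists A B, cut (adj I) U A B /\ clique (adj I) (U :\: (A :|: B)).
  move=> /exists_maximal_cut[A [B [cAB maxAB]]]; exists A, B; split=> //.
  have [ABU dAB A0 B0 eAB] := cutP _ _ _ _ cAB.
  apply/cliqueP => u v; rewrite !in_setD => /andP[uAB uU] /andP[vAB vU] uv.
  apply: (minimal_separator_adj quadI linK uv dAB uAB vAB eAB) => D [->|->] f fe.
    exact: (maximal_cut_connected asym cAB maxAB).
  apply: (maximal_cut_connected asym (U := U) (A := B) (B := A)) => //.
  - by rewrite cutC.
  - by move=> A' B'; rewrite [B :|: A]setUC; exact: maxAB.
  - by rewrite setUC.
  - by rewrite setUC.
have [|A B cAB|i _ ii|bs [dbs bsP]] := box_partition asym (nonloop_indep quadI linK)
    (nonloop_simplicial quadI linK) clique_cut (U := setT) (d := size s).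
- by rewrite cardsT card_ord; exact: (depth_le_dim quadI koszul).
- have [_ dAB /set0Pn[a aA] /set0Pn[b bB] eAB] := cutP _ _ _ _ cAB.
  by rewrite setTD; apply: (depth_le_cut quadI koszul aA bB).
- rewrite (_ : nbhd _ _ _ = [set j | adj I i j]); first exact: (depth_le_nonloop quadI koszul).
  by apply/setP => j; rewrite !inE.
have {}bsP m : count (in_box m) bs = standard (adj I) m.
  by rewrite bsP (_ : supported _ _) ?andbT //; apply/supportedP => i _; rewrite inE.
have stan := box_family_stanley quadI bsP.
pose Q d := exists2 D : stanley_family K n,
  stanley_decomposition I D & sdepth_decomposition D = d.
have Qbs : Q (sdepth_decomposition (box_family K bs)) by exists (box_family K bs).
have [||_ maxQ] := @greatestP Q n.
- by exists (sdepth_decomposition (box_family K bs)).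
- move=> _ [D _ <-]; rewrite /sdepth_decomposition; elim/big_ind: _ => // [x y xn _|k _].
    by rewrite geq_min xn.
  by rewrite -[leqRHS]card_ord max_card.
apply: leq_trans (maxQ _ Qbs); rewrite /sdepth_decomposition.
(* The minimum starts from the default n, so d <= n is needed besides the bound on each box. *)
elim/big_ind: _ => [|x y dx dy|k _]; first exact: (depth_le_dim quadI koszul).
  by rewrite leq_min dx.
by apply: dbs; exact: mem_nth.
Qed.
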